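(* Let $R$ be a Frobenius separable algebra (i.e. both Frobenius and separable) in a monoidal category $\mathcal{C}$ with coequalizers in which every object is coflat and left robust, and let $X$ be an $R$-bimodule in $\mathcal{C}$. Then $X$ admits a right dual in ${}_R\mathcal{C}_R$ if and only if $X$ admits a right dual in $\mathcal{C}$; and likewise $X$ admits a left dual in ${}_R\mathcal{C}_R$ if and only if $X$ admits a left dual in $\mathcal{C}$.
   Context: Monoidal categories are taken strict, with tensor product $\otimes$ and unit object $\underline{1}$; $m_A,\eta_A$ denote multiplication and unit of an algebra $A$. An object $X$ is coflat if $X\otimes-$ and $-\otimes X$ preserve coequalizers. For a right $R$-module $(X,\nu^R_X)$ and a left $R$-module $(Y,\mu^R_Y)$, $q^R_{X,Y}:X\otimes Y\to X\otimes_RY$ is the coequalizer of $\nu^R_X\otimes\mathrm{Id}_Y$ and $\mathrm{Id}_X\otimes\mu^R_Y$. A left $R$-module $Y$ is left robust if for all objects $M$ and right $R$-modules $X$ the morphism $\theta'_{M,X,Y}:(M\otimes X)\otimes_RY\to M\otimes(X\otimes_RY)$ with $\theta'_{M,X,Y}q^R_{M\otimes X,Y}=\mathrm{Id}_M\otimes q^R_{X,Y}$ is an isomorphism; ''every object is left robust'' means this for every algebra $R$ and every left $R$-module. Under these hypotheses the category ${}_R\mathcal{C}_R$ of $R$-bimodules is monoidal with tensor product $\otimes_R$ ($X\otimes_RY$ having $R$-actions induced by the left action on $X$ and the right action on $Y$), unit object $R$, associativity constraint $\Sigma'_{M,X,Y}:(M\otimes_RX)\otimes_RY\to M\otimes_R(X\otimes_RY)$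 determined by $\Sigma'_{M,X,Y}q^R_{M\otimes_RX,Y}(q^R_{M,X}\otimes\mathrm{Id}_Y)=q^R_{M,X\otimes_RY}(\mathrm{Id}_M\otimes q^R_{X,Y})$, and unit constraints induced by the actions. In a monoidal category (constraints suppressed), a left dual of $X$ is an object $X^*$ with morphisms $\mathrm{ev}_X:X^*\otimes X\to\underline{1}$, $\mathrm{coev}_X:\underline{1}\to X\otimes X^*$ such that $(\mathrm{Id}_X\otimes\mathrm{ev}_X)(\mathrm{coev}_X\otimes\mathrm{Id}_X)=\mathrm{Id}_X$ and $(\mathrm{ev}_X\otimes\mathrm{Id}_{X^*})(\mathrm{Id}_{X^*}\otimes\mathrm{coev}_X)=\mathrm{Id}_{X^*}$; a right dual of $X$ is an object ${}^*X$ with $\mathrm{ev}'_X:X\otimes{}^*X\to\underline{1}$, $\mathrm{coev}'_X:\underline{1}\to{}^*X\otimes X$ such that $(\mathrm{ev}'_X\otimes\mathrm{Id}_X)(\mathrm{Id}_X\otimes\mathrm{coev}'_X)=\mathrm{Id}_X$ and $(\mathrm{Id}_{{}^*X}\otimes\mathrm{ev}'_X)(\mathrm{coev}'_X\otimes\mathrm{Id}_{{}^*X})=\mathrm{Id}_{{}^*X}$. $R$ is Frobenius if there are $\vartheta:R\to\underline{1}$, $e:\underline{1}\to R\otimes R$ with $(m_R\otimes\mathrm{Id}_R)(\mathrm{Id}_R\otimes e)=(\mathrm{Id}_R\otimes m_R)(e\otimes\mathrm{Id}_R)$ and $(\vartheta\otimes\mathrm{Id}_R)e=\eta_R=(\mathrm{Id}_R\otimes\vartheta)e$.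 $R$ is separable if there is an $R$-bimodule morphism $\gamma:R\to R\otimes R$ with $m_R\gamma=\mathrm{Id}_R$. *)

(* Defs.v *)
From Stdlib Require Import ssreflect.
From Stdlib Require Import Description ProofIrrelevance.

Set Implicit Arguments.
Unset Strict Implicit.
Unset Printing Implicit Defensive.

Declare Scope mcat_scope.
Delimit Scope mcat_scope with mcat.
Open Scope mcat_scope.

Record category := Category {
  ob :> Type;
  hom : ob -> ob -> Type;
  idm : forall a, hom a a;
  comp : forall a b c, hom b c -> hom a b -> hom a c;
  comp1m : forall a b (f : hom a b), comp (idm b) f = f;
  compm1 : forall a b (f : hom a b), comp f (idm a) = f;
  compA : forall a b c d (f : hom c d) (g : hom b c) (h : hom a b),
    comp (comp f g) h = comp f (comp g h) }.

Arguments hom {_} _ _.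
Arguments idm {_} _.
Arguments comp {_ _ _ _} _ _.
Arguments comp1m {_ _ _} _.
Arguments compm1 {_ _ _} _.
Arguments compA {_ _ _ _ _} _ _ _.

Notation "f ∘ g" := (comp f g) (at level 41, right associativity) : mcat_scope.

Definition is_iso (C : category) (a b : C) (f : hom a b) : Prop :=
  exists g : hom b a, g ∘ f = idm a /\ f ∘ g = idm b.

(* General (not necessarily strict) monoidal categories: a strict one is the case
   where assoc, lunit and runit are identities, and all the definitions below
   carry the constraints that are suppressed in the strict notation. *)
Record monoidal_category := MonoidalCategory {
  mcat :> category;
  tens : mcat -> mcat -> mcat;
  tensm : forall a b c d : mcat,
    hom a b -> hom c d -> hom (tens a c) (tens b d);
  unit_ob : mcat;
  assoc : forall a b c, hom (tens (tens a b) c) (tens a (tens b c));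
  associ : forall a b c, hom (tens a (tens b c)) (tens (tens a b) c);
  lunit : forall a, hom (tens unit_ob a) a;
  luniti : forall a, hom a (tens unit_ob a);
  runit : forall a, hom (tens a unit_ob) a;
  runiti : forall a, hom a (tens a unit_ob);
  tens1 : forall a b, tensm (idm a) (idm b) = idm (tens a b);
  tensC : forall a b c a' b' c'
      (f : hom b c) (g : hom a b) (f' : hom b' c') (g' : hom a' b'),
    tensm (f ∘ g) (f' ∘ g') = tensm f f' ∘ tensm g g';
  assocK : forall a b c, associ a b c ∘ assoc a b c = idm _;
  associK : forall a b c, assoc a b c ∘ associ a b c = idm _;
  lunitK : forall a, luniti a ∘ lunit a = idm _;
  lunitiK : forall a, lunit a ∘ luniti a = idm _;
  runitK : forall a, runiti a ∘ runit a = idm _;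
  runitiK : forall a, runit a ∘ runiti a = idm _;
  assoc_nat : forall a b c a' b' c'
      (f : hom a a') (g : hom b b') (h : hom c c'),
    assoc a' b' c' ∘ tensm (tensm f g) h = tensm f (tensm g h) ∘ assoc a b c;
  lunit_nat : forall a b (f : hom a b),
    lunit b ∘ tensm (idm unit_ob) f = f ∘ lunit a;
  runit_nat : forall a b (f : hom a b),
    runit b ∘ tensm f (idm unit_ob) = f ∘ runit a;
  pentagon : forall a b c d,
    tensm (idm a) (assoc b c d) ∘ assoc a (tens b c) d ∘ tensm (assoc a b c) (idm d)
    = assoc a b (tens c d) ∘ assoc (tens a b) c d;
  triangle : forall a b,
    tensm (idm a) (lunit b) ∘ assoc a unit_ob b = tensm (runit a) (idm b) }.

Arguments tens {_} _ _.
Arguments tensm {_ _ _ _ _} _ _.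
Arguments unit_ob {_}.
Arguments assoc {_} _ _ _.
Arguments associ {_} _ _ _.
Arguments lunit {_} _.
Arguments luniti {_} _.
Arguments runit {_} _.
Arguments runiti {_} _.
Arguments tens1 {_} _ _.
Arguments tensC {_ _ _ _ _ _ _} _ _ _ _.
Arguments assocK {_} _ _ _.
Arguments associK {_} _ _ _.
Arguments lunitK {_} _.
Arguments lunitiK {_} _.
Arguments runitK {_} _.
Arguments runitiK {_} _.
Arguments assoc_nat {_ _ _ _ _ _ _} _ _ _.
Arguments lunit_nat {_ _ _} _.
Arguments runit_nat {_ _ _} _.
Arguments pentagon {_} _ _ _ _.
Arguments triangle {_} _ _.

Notation "A ⊗ B" := (tens A B) (at level 34, left associativity) : mcat_scope.
Notation "f ⊗₁ g" := (tensm f g) (at level 34, left associativity) : mcat_scope.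
Notation "A ◁ f" := (tensm (idm A) f) (at level 34, left associativity) : mcat_scope.
Notation "f ▷ A" := (tensm f (idm A)) (at level 34, left associativity) : mcat_scope.
Notation "𝟙" := unit_ob : mcat_scope.

Definition is_left_dual (C : monoidal_category) (X D : C)
    (ev : hom (D ⊗ X) 𝟙) (coev : hom 𝟙 (X ⊗ D)) : Prop :=
  runit X ∘ (X ◁ ev) ∘ assoc X D X ∘ (coev ▷ X) ∘ luniti X = idm X
  /\ lunit D ∘ (ev ▷ D) ∘ associ D X D ∘ (D ◁ coev) ∘ runiti D = idm D.

Definition is_right_dual (C : monoidal_category) (X D : C)
    (ev : hom (X ⊗ D) 𝟙) (coev : hom 𝟙 (D ⊗ X)) : Prop :=
  lunit X ∘ (ev ▷ X) ∘ associ X D X ∘ (X ◁ coev) ∘ runiti X = idm X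
  /\ runit D ∘ (D ◁ ev) ∘ assoc D X D ∘ (coev ▷ D) ∘ luniti D = idm D.

Definition has_left_dual (C : monoidal_category) (X : C) : Prop :=
  exists (D : C) (ev : hom (D ⊗ X) 𝟙) (coev : hom 𝟙 (X ⊗ D)),
    is_left_dual ev coev.

Definition has_right_dual (C : monoidal_category) (X : C) : Prop :=
  exists (D : C) (ev : hom (X ⊗ D) 𝟙) (coev : hom 𝟙 (D ⊗ X)),
    is_right_dual ev coev.

Definition is_coequalizer (C : category) (a b c : C) (f g : hom a b) (q : hom b c)
    : Prop :=
  q ∘ f = q ∘ g
  /\ forall (z : C) (h : hom b z), h ∘ f = h ∘ g -> exists! u : hom c z, u ∘ q = h.

Record coequalizer (C : category) (a b : C) (f g : hom a b) := Coequalizer {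
  coeq_ob : C;
  coeq_map : hom b coeq_ob;
  coeqP : is_coequalizer f g coeq_map }.

(* A choice of coequalizer for every parallel pair. *)
Definition coequalizers (C : category) : Type :=
  forall (a b : C) (f g : hom a b), coequalizer f g.

Definition coflat (C : monoidal_category) (X : C) : Prop :=
  forall (a b c : C) (f g : hom a b) (q : hom b c), is_coequalizer f g q ->
    is_coequalizer (X ◁ f) (X ◁ g) (X ◁ q)
    /\ is_coequalizer (f ▷ X) (g ▷ X) (q ▷ X).

Section Descent.
Context {C : category} {a b c : C} {f g : hom a b} {q : hom b c}.
Context (cq : is_coequalizer f g q).

(* Factorizations are unique, so unique choice turns them into functions. *)
Definition coeq_desc (z : C) (h : hom b z) (hfg : h ∘ f = h ∘ g) : hom c z :=
  proj1_sig (constructive_definite_description _ (proj2 cq z h hfg)).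

Lemma coeq_descE (z : C) (h : hom b z) (hfg : h ∘ f = h ∘ g) :
  coeq_desc hfg ∘ q = h.
Proof. rewrite /coeq_desc; by case: constructive_definite_description. Qed.

Lemma coeq_epi (z : C) (u v : hom c z) : u ∘ q = v ∘ q -> u = v.
Proof.
move=> e; case: (proj2 cq z (u ∘ q)) => [|w [_ hw]].
  by rewrite !compA (proj1 cq).
by rewrite -(hw u eq_refl) -(hw v (eq_sym e)).
Qed.

End Descent.

Record algebra (C : monoidal_category) := Algebra {
  acar :> C;
  amul : hom (acar ⊗ acar) acar;
  aone : hom 𝟙 acar;
  amulA : amul ∘ (amul ▷ acar) = amul ∘ (acar ◁ amul) ∘ assoc acar acar acar;
  amul1l : amul ∘ (aone ▷ acar) = lunit acar;
  amul1r : amul ∘ (acar ◁ aone) = runit acar }.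

Arguments amul {_} _.
Arguments aone {_} _.

Definition is_laction (C : monoidal_category) (R : algebra C) (Y : C)
    (mu : hom (R ⊗ Y) Y) : Prop :=
  mu ∘ (amul R ▷ Y) = mu ∘ (R ◁ mu) ∘ assoc R R Y
  /\ mu ∘ (aone R ▷ Y) = lunit Y.

Definition is_raction (C : monoidal_category) (R : algebra C) (X : C)
    (nu : hom (X ⊗ R) X) : Prop :=
  nu ∘ (nu ▷ R) = nu ∘ (X ◁ amul R) ∘ assoc X R R
  /\ nu ∘ (X ◁ aone R) = runit X.

Record lmodule (C : monoidal_category) (R : algebra C) := LModule {
  lcar :> C;
  lact : hom (R ⊗ lcar) lcar;
  lactP : is_laction lact }.

Record rmodule (C : monoidal_category) (R : algebra C) := RModule {
  rcar :> C;
  ract : hom (rcar ⊗ R) rcar;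
  ractP : is_raction ract }.

Arguments lact {_ _} _.
Arguments ract {_ _} _.

Record bimodule (C : monoidal_category) (R : algebra C) := Bimodule {
  bcar :> C;
  blact : hom (R ⊗ bcar) bcar;
  bract : hom (bcar ⊗ R) bcar;
  blactP : is_laction blact;
  bractP : is_raction bract;
  bactA : bract ∘ (blact ▷ R) = blact ∘ (R ◁ bract) ∘ assoc R bcar R }.

Arguments blact {_ _} _.
Arguments bract {_ _} _.

Definition bimod_l (C : monoidal_category) (R : algebra C) (X : bimodule R) : lmodule R :=
  LModule (blactP X).
Definition bimod_r (C : monoidal_category) (R : algebra C) (X : bimodule R) : rmodule R :=
  RModule (bractP X).
Coercion bimod_l : bimodule >-> lmodule.
Coercion bimod_r : bimodule >-> rmodule.

Definition is_bimodule_map (C : monoidal_category) (R : algebra C)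
    (X Y : bimodule R) (f : hom (bcar X) (bcar Y)) : Prop :=
  f ∘ blact X = blact Y ∘ (R ◁ f) /\ f ∘ bract X = bract Y ∘ (f ▷ R).

Section Coherence.
Context {C : monoidal_category}.
Implicit Types a b c d : C.

Lemma tail (a b c z : C) (f : hom b c) (g : hom a b) h :
  f ∘ g = h -> forall t : hom z a, f ∘ g ∘ t = h ∘ t.
Proof. by move=> <- t; rewrite compA. Qed.

Lemma tail2 (a b b' c z : C) (f : hom b c) (g : hom a b) (f' : hom b' c) g' :
  f ∘ g = f' ∘ g' -> forall t : hom z a, f ∘ g ∘ t = f' ∘ g' ∘ t.
Proof. by move=> e t; rewrite -[RHS]compA -e !compA. Qed.

Lemma tail3 (a b b' c d z : C) (f : hom c d) (g : hom b c) (h : hom a b)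
    (f' : hom b' d) g' :
  f ∘ g ∘ h = f' ∘ g' -> forall t : hom z a, f ∘ g ∘ h ∘ t = f' ∘ g' ∘ t.
Proof. by move=> e t; rewrite -[RHS]compA -e !compA. Qed.

Lemma tail3k (a b c d z : C) (f : hom c d) (g : hom b c) (h : hom a b) k :
  f ∘ g ∘ h = k -> forall t : hom z a, f ∘ g ∘ h ∘ t = k ∘ t.
Proof. by move=> <- t; rewrite !compA. Qed.

Lemma comp_tens a b c a' b' c'
    (f : hom b c) (g : hom a b) (f' : hom b' c') (g' : hom a' b') :
  (f ⊗₁ f') ∘ (g ⊗₁ g') = (f ∘ g) ⊗₁ (f' ∘ g').
Proof. by rewrite tensC. Qed.

Lemma whiskl a b c {d : C} (f : hom b c) (g : hom a b) :
  (d ◁ f) ∘ (d ◁ g) = d ◁ (f ∘ g).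
Proof. by rewrite comp_tens comp1m. Qed.

Lemma whiskr a b c {d : C} (f : hom b c) (g : hom a b) :
  (f ▷ d) ∘ (g ▷ d) = (f ∘ g) ▷ d.
Proof. by rewrite comp_tens comp1m. Qed.

Lemma slide a b c d (f : hom a b) (g : hom c d) :
  (f ▷ d) ∘ (a ◁ g) = (b ◁ g) ∘ (f ▷ c).
Proof. by rewrite !comp_tens !comp1m !compm1. Qed.

Lemma associ_nat a b c a' b' c' (f : hom a a') (g : hom b b') (h : hom c c') :
  associ a' b' c' ∘ (f ⊗₁ (g ⊗₁ h)) = (f ⊗₁ g ⊗₁ h) ∘ associ a b c.
Proof.
rewrite -[LHS]compm1 -(associK a b c) !compA -(tail2 (assoc_nat f g h)).
by rewrite (tail (assocK a' b' c')) comp1m.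
Qed.

Lemma assoc_natr {a b c c' : C} (f : hom c c') :
  assoc a b c' ∘ (a ⊗ b ◁ f) = (a ◁ (b ◁ f)) ∘ assoc a b c.
Proof. by rewrite -tens1 assoc_nat. Qed.

Lemma assoc_natl {a b c a' : C} (f : hom a a') :
  assoc a' b c ∘ (f ▷ b ▷ c) = (f ▷ (b ⊗ c)) ∘ assoc a b c.
Proof. by rewrite -tens1 assoc_nat. Qed.

Lemma associ_natl {a b c a' : C} (f : hom a a') :
  associ a' b c ∘ (f ▷ (b ⊗ c)) = (f ▷ b ▷ c) ∘ associ a b c.
Proof. by rewrite -tens1 associ_nat. Qed.

Lemma associ_natr {a b c c' : C} (f : hom c c') :
  associ a b c' ∘ (a ◁ (b ◁ f)) = (a ⊗ b ◁ f) ∘ associ a b c.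
Proof. by rewrite -tens1 associ_nat. Qed.

Lemma whiskl1 a b c (f : hom a b) (g : hom b a) :
  f ∘ g = idm b -> (c ◁ f) ∘ (c ◁ g) = idm _.
Proof. by move=> e; rewrite whiskl e tens1. Qed.

Lemma whiskr1 a b c (f : hom a b) (g : hom b a) :
  f ∘ g = idm b -> (f ▷ c) ∘ (g ▷ c) = idm _.
Proof. by move=> e; rewrite whiskr e tens1. Qed.

Lemma iso_epi a b c (f : hom a b) (g : hom b a) (u v : hom b c) :
  f ∘ g = idm b -> u ∘ f = v ∘ f -> u = v.
Proof. by move=> e h; rewrite -[u]compm1 -[v]compm1 -e -!compA h. Qed.

Lemma iso_mono a b c (f : hom a b) (g : hom b a) (u v : hom c a) :
  g ∘ f = idm a -> f ∘ u = f ∘ v -> u = v.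
Proof. by move=> e h; rewrite -[u]comp1m -[v]comp1m -e !compA h. Qed.

Lemma pentD a b c d :
  (a ◁ associ b c d) ∘ assoc a b (c ⊗ d) ∘ assoc (a ⊗ b) c d
  = assoc a (b ⊗ c) d ∘ (assoc a b c ▷ d).
Proof.
apply: (iso_mono (whiskl1 a (assocK b c d))).
by rewrite (tail (whiskl1 a (associK b c d))) comp1m pentagon.
Qed.

Lemma pentC a b c d :
  assoc (a ⊗ b) c d ∘ (associ a b c ▷ d)
  = associ a b (c ⊗ d) ∘ (a ◁ assoc b c d) ∘ assoc a (b ⊗ c) d.
Proof.
apply: (iso_epi (whiskr1 d (associK a b c))).
rewrite !compA pentagon (whiskr1 d (assocK a b c)) compm1.
by rewrite (tail (assocK a b (c ⊗ d))) comp1m.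
Qed.

Lemma pentA a b c d :
  assoc (a ⊗ b) c d ∘ (associ a b c ▷ d) ∘ associ a (b ⊗ c) d
  = associ a b (c ⊗ d) ∘ (a ◁ assoc b c d).
Proof. by rewrite (tail (pentC a b c d)) !compA associK compm1. Qed.

Lemma pentB a b c d :
  (assoc a b c ▷ d) ∘ associ (a ⊗ b) c d
  = associ a (b ⊗ c) d ∘ (a ◁ associ b c d) ∘ assoc a b (c ⊗ d).
Proof.
apply: (iso_mono (assocK a (b ⊗ c) d)).
rewrite -(tail3 (pentD a b c d)) associK compm1.
by rewrite (tail (associK a (b ⊗ c) d)) comp1m.
Qed.

Lemma lunit_inj a b (f g : hom a b) : 𝟙 ◁ f = 𝟙 ◁ g -> f = g.
Proof. by move=> e; apply: (iso_epi (lunitiK a)); rewrite -!lunit_nat e. Qed.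

Lemma runit_inj a b (f g : hom a b) : f ▷ 𝟙 = g ▷ 𝟙 -> f = g.
Proof. by move=> e; apply: (iso_epi (runitiK a)); rewrite -!runit_nat e. Qed.

Lemma lunit_tens a b : lunit (a ⊗ b) ∘ assoc 𝟙 a b = lunit a ▷ b.
Proof.
apply: lunit_inj.
apply: (iso_epi (f := assoc 𝟙 (𝟙 ⊗ a) b ∘ (assoc 𝟙 𝟙 a ▷ b))
                (g := (associ 𝟙 𝟙 a ▷ b) ∘ associ 𝟙 (𝟙 ⊗ a) b)).
  by rewrite compA (tail (whiskr1 b (associK 𝟙 𝟙 a))) comp1m associK.
rewrite -whiskl compA pentagon -(tail2 (assoc_nat _ _ _)) whiskr triangle.
by rewrite assoc_nat tens1 -compA triangle.
Qed.

Lemma runit_tens a b : (a ◁ runit b) ∘ assoc a b 𝟙 = runit (a ⊗ b).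
Proof.
apply: runit_inj.
apply: (iso_mono (assocK a b 𝟙)).
rewrite -whiskr -compA assoc_nat compA -!triangle -whiskl compA pentagon.
by rewrite -tens1 (tail2 (assoc_nat _ _ _)).
Qed.

Lemma lunit_tens' a b : (lunit a ▷ b) ∘ associ 𝟙 a b = lunit (a ⊗ b).
Proof. by rewrite -lunit_tens compA associK compm1. Qed.

End Coherence.

Section TensorOver.
Context {C : monoidal_category} (cq : coequalizers C) {R : algebra C}.
Implicit Types (X : rmodule R) (Y : lmodule R).

Definition bal_l X Y : hom (X ⊗ R ⊗ Y) (X ⊗ Y) := ract X ▷ Y.
Definition bal_r X Y : hom (X ⊗ R ⊗ Y) (X ⊗ Y) := (X ◁ lact Y) ∘ assoc X R Y.

Definition tens_over X Y : C := coeq_ob (cq (bal_l X Y) (bal_r X Y)).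
Definition qmap X Y : hom (X ⊗ Y) (tens_over X Y) :=
  coeq_map (cq (bal_l X Y) (bal_r X Y)).
Definition qmapP X Y : is_coequalizer (bal_l X Y) (bal_r X Y) (qmap X Y) :=
  coeqP (cq (bal_l X Y) (bal_r X Y)).

Lemma qbal X Y : qmap X Y ∘ (ract X ▷ Y) = qmap X Y ∘ (X ◁ lact Y) ∘ assoc X R Y.
Proof. exact: (proj1 (qmapP X Y)). Qed.

Lemma rmod_tens_subproof (M : C) X :
  is_raction ((M ◁ ract X) ∘ assoc M X R).
Proof.
have [nuA nu1] := ractP X.
split.
- rewrite -whiskr !compA (tail2 (assoc_nat _ _ _)) (tail (whiskl _ _)) nuA.
  by rewrite -!whiskl !compA pentagon -(tail2 (assoc_nat _ _ _)) tens1.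
- by rewrite -tens1 compA assoc_nat (tail (whiskl _ _)) nu1 runit_tens.
Qed.

Definition rmod_tens (M : C) X : rmodule R := RModule (rmod_tens_subproof M X).

Lemma theta_subproof (M : C) X Y :
  ((M ◁ qmap X Y) ∘ assoc M X Y) ∘ bal_l (rmod_tens M X) Y
  = ((M ◁ qmap X Y) ∘ assoc M X Y) ∘ bal_r (rmod_tens M X) Y.
Proof.
rewrite /bal_l /bal_r /= -whiskr !compA (tail2 (assoc_nat _ _ _)).
rewrite (tail (whiskl _ _)) qbal -!whiskl !compA pentagon.
by rewrite -tens1 (tail2 (assoc_nat _ _ _)).
Qed.

(* The comparison morphism of left robustness, determined by thetaE. *)
Definition theta (M : C) X Y :
    hom (tens_over (rmod_tens M X) Y) (M ⊗ tens_over X Y) :=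
  coeq_desc (qmapP (rmod_tens M X) Y) (theta_subproof M X Y).

Lemma thetaE (M : C) X Y :
  theta M X Y ∘ qmap (rmod_tens M X) Y = (M ◁ qmap X Y) ∘ assoc M X Y.
Proof. exact: coeq_descE. Qed.

Definition left_robust Y : Prop := forall (M : C) X, is_iso (theta M X Y).

End TensorOver.

Section BimoduleMaps.
Context {C : monoidal_category} {R : algebra C}.

Lemma bimodule_map_id (X : bimodule R) : is_bimodule_map (idm X).
Proof. by split; rewrite tens1 comp1m compm1. Qed.

Lemma bimodule_map_comp (X Y Z : bimodule R) (g : hom Y Z) (f : hom X Y) :
  is_bimodule_map g -> is_bimodule_map f -> is_bimodule_map (g ∘ f).
Proof.
move=> [gl gr] [fl fr]; split.
- by rewrite compA fl (tail2 gl) whiskl.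
- by rewrite compA fr (tail2 gr) whiskr.
Qed.

Lemma bimodule_map_inv (X Y : bimodule R) (f : hom X Y) (g : hom Y X) :
  g ∘ f = idm _ -> f ∘ g = idm _ -> is_bimodule_map f -> is_bimodule_map g.
Proof.
move=> gf fg [fl fr]; split; apply: (iso_mono gf).
- by rewrite (tail fg) comp1m (tail2 fl) whiskl fg tens1 compm1.
- by rewrite (tail fg) comp1m (tail2 fr) whiskr fg tens1 compm1.
Qed.

Definition bimodule_hom (X Y : bimodule R) : Type :=
  {f : hom X Y | is_bimodule_map f}.

Lemma bimodule_hom_eq (X Y : bimodule R) (f g : bimodule_hom X Y) :
  proj1_sig f = proj1_sig g -> f = g.
Proof.
case: f g => [f pf] [g pg] /= e; case: _ / e pg => pg.
by rewrite (proof_irrelevance _ pf pg).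
Qed.

Definition bimodule_cat : category.
Proof.
refine (@Category (bimodule R) bimodule_hom
  (fun X => exist _ (idm X) (bimodule_map_id X))
  (fun X Y Z g f => exist _ (proj1_sig g ∘ proj1_sig f)
     (bimodule_map_comp (proj2_sig g) (proj2_sig f))) _ _ _).
- by move=> X Y f; apply: bimodule_hom_eq; rewrite /= comp1m.
- by move=> X Y f; apply: bimodule_hom_eq; rewrite /= compm1.
- by move=> X Y Z T f g h; apply: bimodule_hom_eq; rewrite /= compA.
Defined.

End BimoduleMaps.

Arguments bimodule_cat {C} R.
Arguments bimodule_hom {C} R _ _.

Section RegularBimodule.
Context {C : monoidal_category} (R : algebra C).

Lemma reg_lactP : is_laction (amul R).
Proof. split; [exact: amulA | exact: amul1l]. Qed.

Lemma reg_ractP : is_raction (amul R).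
Proof. split; [exact: amulA | exact: amul1r]. Qed.

Definition reg_bimod : bimodule R :=
  Bimodule reg_lactP reg_ractP (amulA R).

(* R ⊗ R with the outer actions. *)
Lemma sq_lactP : is_laction ((amul R ▷ R) ∘ associ R R R).
Proof.
split.
- rewrite compA -{1}tens1 associ_nat (tail (whiskr _ _)) amulA -!whiskr !compA.
  rewrite pentB -[in RHS]whiskl !compA.
  by rewrite (tail2 (associ_nat _ _ _)).
- by rewrite compA -tens1 associ_nat (tail (whiskr _ _)) amul1l lunit_tens'.
Qed.

Lemma sq_ractP : is_raction ((R ◁ amul R) ∘ assoc R R R).
Proof. exact: (rmod_tens_subproof R (RModule reg_ractP)). Qed.

Lemma sq_actA :
  ((R ◁ amul R) ∘ assoc R R R) ∘ (((amul R ▷ R) ∘ associ R R R) ▷ R)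
  = ((amul R ▷ R) ∘ associ R R R) ∘ (R ◁ ((R ◁ amul R) ∘ assoc R R R))
      ∘ assoc R (R ⊗ R) R.
Proof.
rewrite -whiskr -whiskl !compA (tail2 (assoc_nat _ _ _)) tens1.
rewrite (tail2 (associ_nat _ _ _)) tens1 pentC.
by rewrite -(tail2 (slide _ _)).
Qed.

Definition sq_bimod : bimodule R := Bimodule sq_lactP sq_ractP sq_actA.

End RegularBimodule.

Definition frobenius (C : monoidal_category) (R : algebra C) : Prop :=
  exists (th : hom R 𝟙) (e : hom 𝟙 (R ⊗ R)),
    (amul R ▷ R) ∘ associ R R R ∘ (R ◁ e) ∘ runiti R
      = (R ◁ amul R) ∘ assoc R R R ∘ (e ▷ R) ∘ luniti R
    /\ lunit R ∘ (th ▷ R) ∘ e = aone R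
    /\ runit R ∘ (R ◁ th) ∘ e = aone R.

Definition separable (C : monoidal_category) (R : algebra C) : Prop :=
  exists gam : hom R (R ⊗ R),
    is_bimodule_map (X := reg_bimod R) (Y := sq_bimod R) gam
    /\ amul R ∘ gam = idm R.

Section BimoduleTensor.
Context {C : monoidal_category} (cq : coequalizers C) (cf : forall X : C, coflat X).
Context {R : algebra C}.
Implicit Types X Y Z M N : bimodule R.

Local Notation "X ⊙ Y" := (tens_over cq (bimod_r X) (bimod_l Y))
  (at level 34, left associativity).
Local Notation q X Y := (qmap cq (bimod_r X) (bimod_l Y)).

Lemma qbimod X Y :
  q X Y ∘ (bract X ▷ bcar Y) = q X Y ∘ (bcar X ◁ blact Y) ∘ assoc (bcar X) R (bcar Y).
Proof. exact: (qbal cq (bimod_r X) (bimod_l Y)). Qed.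

Lemma qepi X Y (z : C) (u v : hom (X ⊙ Y) z) : u ∘ q X Y = v ∘ q X Y -> u = v.
Proof. exact: (coeq_epi (qmapP cq (bimod_r X) (bimod_l Y))). Qed.

Lemma lqepi (A : C) X Y (z : C) (u v : hom (A ⊗ (X ⊙ Y)) z) :
  u ∘ (A ◁ q X Y) = v ∘ (A ◁ q X Y) -> u = v.
Proof. exact: (coeq_epi (proj1 (cf A (qmapP cq (bimod_r X) (bimod_l Y))))). Qed.

Lemma rqepi (A : C) X Y (z : C) (u v : hom ((X ⊙ Y) ⊗ A) z) :
  u ∘ (q X Y ▷ A) = v ∘ (q X Y ▷ A) -> u = v.
Proof. exact: (coeq_epi (proj2 (cf A (qmapP cq (bimod_r X) (bimod_l Y))))). Qed.

Lemma lrqepi (A B : C) X Y (z : C) (u v : hom (A ⊗ ((X ⊙ Y) ⊗ B)) z) :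
  u ∘ (A ◁ (q X Y ▷ B)) = v ∘ (A ◁ (q X Y ▷ B)) -> u = v.
Proof.
exact: (coeq_epi (proj1 (cf A (proj2 (cf B (qmapP cq (bimod_r X) (bimod_l Y))))))).
Qed.

Lemma rrqepi (A B : C) X Y (z : C) (u v : hom ((X ⊙ Y) ⊗ A ⊗ B) z) :
  u ∘ (q X Y ▷ A ▷ B) = v ∘ (q X Y ▷ A ▷ B) -> u = v.
Proof.
exact: (coeq_epi (proj2 (cf B (proj2 (cf A (qmapP cq (bimod_r X) (bimod_l Y))))))).
Qed.

Lemma rlqepi (A B : C) X Y (z : C) (u v : hom (A ⊗ (X ⊙ Y) ⊗ B) z) :
  u ∘ ((A ◁ q X Y) ▷ B) = v ∘ ((A ◁ q X Y) ▷ B) -> u = v.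
Proof.
exact: (coeq_epi (proj2 (cf B (proj1 (cf A (qmapP cq (bimod_r X) (bimod_l Y))))))).
Qed.

Lemma tlact_subproof X Y :
  let h := q X Y ∘ (blact X ▷ bcar Y) ∘ associ R (bcar X) (bcar Y) in
  h ∘ (R ◁ bal_l X Y) = h ∘ (R ◁ bal_r X Y).
Proof.
rewrite /bal_l /bal_r /= ?compA associ_nat (tail (whiskr _ _)).
have -> : blact X ∘ (R ◁ bract X) = bract X ∘ (blact X ▷ R) ∘ associ R (bcar X) R.
  by rewrite (tail2 (bactA X)) ?compA associK compm1.
rewrite -!whiskr ?compA (tail (qbimod X Y)) ?compA.
rewrite (tail2 (assoc_natl _)) pentA -!whiskl.
rewrite [in RHS](tail2 (associ_natr _)).
by rewrite -!(tail2 (slide _ _)).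
Qed.

Definition tlact X Y : hom (R ⊗ (X ⊙ Y)) (X ⊙ Y) :=
  coeq_desc (proj1 (cf R (qmapP cq (bimod_r X) (bimod_l Y)))) (tlact_subproof X Y).

Lemma tlactE X Y :
  tlact X Y ∘ (R ◁ q X Y) = q X Y ∘ (blact X ▷ bcar Y) ∘ associ R (bcar X) (bcar Y).
Proof. exact: coeq_descE. Qed.

Lemma tract_subproof X Y :
  let h := q X Y ∘ (bcar X ◁ bract Y) ∘ assoc (bcar X) (bcar Y) R in
  h ∘ (bal_l X Y ▷ R) = h ∘ (bal_r X Y ▷ R).
Proof.
rewrite /bal_l /bal_r /= ?compA assoc_natl -!whiskr.
rewrite -(tail2 (slide _ _)) (tail (qbimod X Y)) ?compA.
rewrite (tail2 (assoc_natr _)) [in RHS](tail2 (assoc_nat _ _ _)).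
rewrite !(tail (whiskl _ _)) bactA -pentagon -!whiskl ?compA.
done.
Qed.

Definition tract X Y : hom ((X ⊙ Y) ⊗ R) (X ⊙ Y) :=
  coeq_desc (proj2 (cf R (qmapP cq (bimod_r X) (bimod_l Y)))) (tract_subproof X Y).

Lemma tractE X Y :
  tract X Y ∘ (q X Y ▷ R) = q X Y ∘ (bcar X ◁ bract Y) ∘ assoc (bcar X) (bcar Y) R.
Proof. exact: coeq_descE. Qed.

Lemma tlactP X Y : is_laction (tlact X Y).
Proof.
have [muA mu1] := blactP X.
split; apply: lqepi.
- rewrite compA slide (tail (tlactE X Y)) ?compA.
  rewrite associ_natl (tail (whiskr _ _)) muA.
  rewrite assoc_natr (tail (whiskl _ _)) tlactE.
  rewrite -!whiskl ?compA (tail (tlactE X Y)) ?compA.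
  rewrite (tail2 (associ_nat _ _ _)) -!whiskr ?compA.
  by rewrite pentB.
- rewrite compA slide (tail (tlactE X Y)) ?compA.
  rewrite associ_natl (tail (whiskr _ _)) mu1 lunit_tens'.
  by rewrite lunit_nat.
Qed.

Lemma tractP X Y : is_raction (tract X Y).
Proof.
have [nuA nu1] := bractP Y.
split.
- apply: rrqepi.
  rewrite compA whiskr tractE -!whiskr ?compA (tail (tractE X Y)) ?compA.
  rewrite (tail2 (assoc_nat _ _ _)) (tail (whiskl _ _)) nuA.
  rewrite assoc_natl -(tail2 (slide _ _)) (tail (tractE X Y)) ?compA.
  rewrite (tail2 (assoc_natr _)) -pentagon.
  by rewrite -!whiskl ?compA.
- apply: rqepi.
  rewrite compA -slide (tail (tractE X Y)) ?compA.
  rewrite assoc_natr (tail (whiskl _ _)) nu1.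
  by rewrite runit_tens runit_nat.
Qed.

Lemma tactA X Y :
  tract X Y ∘ (tlact X Y ▷ R) = tlact X Y ∘ (R ◁ tract X Y) ∘ assoc R (X ⊙ Y) R.
Proof.
apply: rlqepi.
rewrite compA whiskr tlactE -!whiskr ?compA (tail (tractE X Y)) ?compA.
rewrite (tail2 (assoc_natl _)) assoc_nat (tail (whiskl _ _)) tractE.
rewrite -!whiskl ?compA (tail (tlactE X Y)) ?compA.
rewrite (tail2 (associ_natr _)) -pentC.
by rewrite -(tail2 (slide _ _)).
Qed.

Definition tens_bimod X Y : bimodule R := Bimodule (tlactP X Y) (tractP X Y) (tactA X Y).

Lemma tmap_subproof X X' Y Y' (f : hom X X') (g : hom Y Y') :
  is_bimodule_map f -> is_bimodule_map g ->
  (q X' Y' ∘ (f ⊗₁ g)) ∘ bal_l X Y = (q X' Y' ∘ (f ⊗₁ g)) ∘ bal_r X Y.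
Proof.
move=> [_ fr] [gl _]; rewrite /bal_l /bal_r /= ?compA.
rewrite comp_tens fr compm1 (tail (comp_tens _ _ _ _)) gl compm1.
rewrite -[g]comp1m -[f in RHS]comp1m tensC (tail (qbimod _ _)) ?compA.
rewrite assoc_nat [in RHS]tensC ?compA.
by rewrite !comp1m.
Qed.

Definition tmap X X' Y Y' (f : bimodule_hom R X X') (g : bimodule_hom R Y Y') :
    hom (X ⊙ Y) (X' ⊙ Y') :=
  coeq_desc (qmapP cq (bimod_r X) (bimod_l Y))
    (tmap_subproof (proj2_sig f) (proj2_sig g)).

Lemma tmapE X X' Y Y' (f : bimodule_hom R X X') (g : bimodule_hom R Y Y') :
  tmap f g ∘ q X Y = q X' Y' ∘ (proj1_sig f ⊗₁ proj1_sig g).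
Proof. exact: coeq_descE. Qed.

Lemma tmapP X X' Y Y' (f : bimodule_hom R X X') (g : bimodule_hom R Y Y') :
  is_bimodule_map (X := tens_bimod X Y) (Y := tens_bimod X' Y') (tmap f g).
Proof.
have [fl fr] := proj2_sig f; have [gl gr] := proj2_sig g.
split=> /=.
- apply: lqepi.
  rewrite ?compA tlactE whiskl tmapE -!whiskl ?compA (tail (tmapE f g)) (tail (tlactE _ _)) ?compA.
  rewrite associ_nat !(tail (comp_tens _ _ _ _)) fl.
  by rewrite compm1 comp1m.
- apply: rqepi.
  rewrite ?compA tractE whiskr tmapE -!whiskr ?compA (tail (tmapE f g)) (tail (tractE _ _)) ?compA.
  rewrite assoc_nat !(tail (comp_tens _ _ _ _)) gr.
  by rewrite compm1 comp1m.
Qed.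

Definition bmap X X' Y Y' (f : bimodule_hom R X X') (g : bimodule_hom R Y Y') :
    bimodule_hom R (tens_bimod X Y) (tens_bimod X' Y') :=
  exist _ (tmap f g) (tmapP f g).

Local Notation "X ⊡ Y" := (tens_bimod X Y) (at level 34, left associativity).

Lemma sigma0_subproof M X Y :
  let h := q M (X ⊡ Y) ∘ (bcar M ◁ q X Y) ∘ assoc (bcar M) (bcar X) (bcar Y) in
  h ∘ (bal_l M X ▷ bcar Y) = h ∘ (bal_r M X ▷ bcar Y).
Proof.
rewrite /bal_l /bal_r /= ?compA assoc_natl -!whiskr.
rewrite -(tail2 (slide _ _)) (tail (qbimod M (X ⊡ Y))) ?compA /=.
rewrite (tail2 (assoc_natr _)) (tail (whiskl _ _)) tlactE.
rewrite (tail2 (assoc_nat _ _ _)) -pentD -!whiskl ?compA.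
done.
Qed.

Definition sigma0 M X Y : hom ((M ⊙ X) ⊗ bcar Y) (M ⊙ (X ⊡ Y)) :=
  coeq_desc (proj2 (cf (bcar Y) (qmapP cq (bimod_r M) (bimod_l X))))
    (sigma0_subproof M X Y).

Lemma sigma0E M X Y :
  sigma0 M X Y ∘ (q M X ▷ bcar Y)
  = q M (X ⊡ Y) ∘ (bcar M ◁ q X Y) ∘ assoc (bcar M) (bcar X) (bcar Y).
Proof. exact: coeq_descE. Qed.

Lemma sigma_subproof M X Y :
  sigma0 M X Y ∘ bal_l (M ⊡ X) Y = sigma0 M X Y ∘ bal_r (M ⊡ X) Y.
Proof.
apply: rrqepi.
rewrite /bal_l /bal_r /= ?compA whiskr tractE -!whiskr ?compA (tail (sigma0E M X Y)) ?compA.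
rewrite (tail2 (assoc_nat _ _ _)) (tail (whiskl _ _)) qbimod.
rewrite assoc_natl -(tail2 (slide _ _)) (tail (sigma0E M X Y)) ?compA.
rewrite (tail2 (assoc_natr _)) -pentagon.
by rewrite -!whiskl ?compA.
Qed.

(* Determined by sigmaE; likewise tlact, tract and tmap by tlactE, tractE, tmapE. *)
Definition sigma M X Y : hom ((M ⊡ X) ⊙ Y) (M ⊙ (X ⊡ Y)) :=
  coeq_desc (qmapP cq (bimod_r (M ⊡ X)) (bimod_l Y)) (sigma_subproof M X Y).

Lemma sigmaE M X Y :
  sigma M X Y ∘ q (M ⊡ X) Y ∘ (q M X ▷ bcar Y)
  = q M (X ⊡ Y) ∘ (bcar M ◁ q X Y) ∘ assoc (bcar M) (bcar X) (bcar Y).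
Proof. by rewrite -compA coeq_descE sigma0E. Qed.

Lemma sigmai0_subproof M X Y :
  let h := q (M ⊡ X) Y ∘ (q M X ▷ bcar Y) ∘ associ (bcar M) (bcar X) (bcar Y) in
  h ∘ (bcar M ◁ bal_l X Y) = h ∘ (bcar M ◁ bal_r X Y).
Proof.
rewrite /bal_l /bal_r /= ?compA associ_nat (tail (whiskr _ _)).
have -> : q M X ∘ (bcar M ◁ bract X)
    = tract M X ∘ (q M X ▷ R) ∘ associ (bcar M) (bcar X) R.
  by rewrite (tail (tractE M X)) ?compA associK compm1.
rewrite -!whiskr ?compA (tail (qbimod (M ⊡ X) Y)) ?compA.
rewrite (tail2 (assoc_natl _)) pentA -!whiskl.
rewrite [in RHS](tail2 (associ_natr _)).
by rewrite -!(tail2 (slide _ _)).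
Qed.

Definition sigmai0 M X Y : hom (bcar M ⊗ (X ⊙ Y)) ((M ⊡ X) ⊙ Y) :=
  coeq_desc (proj1 (cf (bcar M) (qmapP cq (bimod_r X) (bimod_l Y))))
    (sigmai0_subproof M X Y).

Lemma sigmai0E M X Y :
  sigmai0 M X Y ∘ (bcar M ◁ q X Y)
  = q (M ⊡ X) Y ∘ (q M X ▷ bcar Y) ∘ associ (bcar M) (bcar X) (bcar Y).
Proof. exact: coeq_descE. Qed.

Lemma sigmai_subproof M X Y :
  sigmai0 M X Y ∘ bal_l M (X ⊡ Y) = sigmai0 M X Y ∘ bal_r M (X ⊡ Y).
Proof.
apply: lqepi.
rewrite /bal_l /bal_r /= ?compA slide (tail (sigmai0E M X Y)) ?compA.
rewrite associ_natl (tail (whiskr _ _)) qbimod.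
rewrite assoc_natr (tail (whiskl _ _)) tlactE.
rewrite -!whiskl ?compA (tail (sigmai0E M X Y)) ?compA.
rewrite (tail2 (associ_nat _ _ _)) -!whiskr ?compA.
by rewrite pentB.
Qed.

Definition sigmai M X Y : hom (M ⊙ (X ⊡ Y)) ((M ⊡ X) ⊙ Y) :=
  coeq_desc (qmapP cq (bimod_r M) (bimod_l (X ⊡ Y))) (sigmai_subproof M X Y).

Lemma sigmaiE M X Y :
  sigmai M X Y ∘ q M (X ⊡ Y) ∘ (bcar M ◁ q X Y)
  = q (M ⊡ X) Y ∘ (q M X ▷ bcar Y) ∘ associ (bcar M) (bcar X) (bcar Y).
Proof. by rewrite -compA coeq_descE sigmai0E. Qed.

Lemma qqlepi M X Y (z : C) (u v : hom ((M ⊡ X) ⊙ Y) z) :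
  u ∘ q (M ⊡ X) Y ∘ (q M X ▷ bcar Y) = v ∘ q (M ⊡ X) Y ∘ (q M X ▷ bcar Y) -> u = v.
Proof. by rewrite -?compA => e; apply: (@qepi (M ⊡ X) Y); apply: rqepi e. Qed.

Lemma qqrepi M X Y (z : C) (u v : hom (M ⊙ (X ⊡ Y)) z) :
  u ∘ q M (X ⊡ Y) ∘ (bcar M ◁ q X Y) = v ∘ q M (X ⊡ Y) ∘ (bcar M ◁ q X Y) -> u = v.
Proof. by rewrite -?compA => e; apply: (@qepi M (X ⊡ Y)); apply: lqepi e. Qed.

Lemma sigmaK M X Y : sigmai M X Y ∘ sigma M X Y = idm _.
Proof.
apply: qqlepi; rewrite ?compA sigmaE.
by rewrite (tail3k (sigmaiE M X Y)) ?compA assocK compm1 comp1m.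
Qed.

Lemma sigmaiK M X Y : sigma M X Y ∘ sigmai M X Y = idm _.
Proof.
apply: qqrepi; rewrite ?compA sigmaiE.
by rewrite (tail3k (sigmaE M X Y)) ?compA associK compm1 comp1m.
Qed.

Lemma sigmaP M X Y :
  is_bimodule_map (X := (M ⊡ X) ⊡ Y) (Y := M ⊡ (X ⊡ Y)) (sigma M X Y).
Proof.
split=> /=.
- apply: lqepi; apply: lrqepi.
  rewrite ?compA (tail (tlactE _ _)) ?compA associ_nat (tail (whiskr _ _)) tlactE.
  rewrite -!whiskr ?compA (tail3k (sigmaE M X Y)) ?compA.
  rewrite (tail2 (assoc_natl _)) pentA !whiskl sigmaE.
  rewrite -!whiskl (tail (tlactE M (X ⊡ Y))) ?compA (tail2 (associ_natr _)).
  by rewrite -(tail2 (slide _ _)).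
- apply: rqepi; apply: rrqepi.
  rewrite ?compA (tail (tractE _ _)) ?compA assoc_natl -(tail2 (slide _ _)).
  rewrite (tail3k (sigmaE M X Y)) ?compA (tail2 (assoc_natr _)).
  rewrite !whiskr sigmaE -!whiskr (tail (tractE M (X ⊡ Y))) ?compA /=.
  rewrite (tail2 (assoc_nat _ _ _)) !(tail (whiskl _ _)) tractE.
  by rewrite -!whiskl ?compA pentagon.
Qed.

Definition bassoc M X Y : bimodule_hom R ((M ⊡ X) ⊡ Y) (M ⊡ (X ⊡ Y)) :=
  exist _ (sigma M X Y) (sigmaP M X Y).

Definition bassoci M X Y : bimodule_hom R (M ⊡ (X ⊡ Y)) ((M ⊡ X) ⊡ Y) :=
  exist _ (sigmai M X Y)
    (bimodule_map_inv (X := (M ⊡ X) ⊡ Y) (Y := M ⊡ (X ⊡ Y))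
       (sigmaK M X Y) (sigmaiK M X Y) (sigmaP M X Y)).

Local Notation I := (reg_bimod R).

Lemma blunit_subproof X : blact X ∘ bal_l I X = blact X ∘ bal_r I X.
Proof. exact: (proj1 (blactP X)). Qed.

Lemma brunit_subproof X : bract X ∘ bal_l X I = bract X ∘ bal_r X I.
Proof. exact: (proj1 (bractP X)). Qed.

Definition tlunit X : hom (I ⊙ X) X :=
  coeq_desc (qmapP cq (bimod_r I) (bimod_l X)) (blunit_subproof X).

Definition trunit X : hom (X ⊙ I) X :=
  coeq_desc (qmapP cq (bimod_r X) (bimod_l I)) (brunit_subproof X).

Lemma tlunitE X : tlunit X ∘ q I X = blact X.
Proof. exact: coeq_descE. Qed.

Lemma trunitE X : trunit X ∘ q X I = bract X.
Proof. exact: coeq_descE. Qed.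

Definition tluniti X : hom X (I ⊙ X) := q I X ∘ (aone R ▷ bcar X) ∘ luniti (bcar X).
Definition truniti X : hom X (X ⊙ I) := q X I ∘ (bcar X ◁ aone R) ∘ runiti (bcar X).

Lemma tlunitiK X : tlunit X ∘ tluniti X = idm (bcar X).
Proof. by rewrite (tail (tlunitE X)) (tail (proj2 (blactP X))) lunitiK. Qed.

Lemma trunitiK X : trunit X ∘ truniti X = idm (bcar X).
Proof. by rewrite (tail (trunitE X)) (tail (proj2 (bractP X))) runitiK. Qed.

Lemma luniti_nat (a b : C) (f : hom a b) : luniti b ∘ f = (𝟙 ◁ f) ∘ luniti a.
Proof.
apply: (iso_mono (lunitK b)).
by rewrite (tail (lunitiK b)) (tail (lunit_nat f)) compA lunitiK comp1m compm1.
Qed.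

Lemma runiti_nat (a b : C) (f : hom a b) : runiti b ∘ f = (f ▷ 𝟙) ∘ runiti a.
Proof.
apply: (iso_mono (runitK b)).
by rewrite (tail (runitiK b)) (tail (runit_nat f)) compA runitiK comp1m compm1.
Qed.

Lemma tlunitK X : tluniti X ∘ tlunit X = idm (I ⊙ X).
Proof.
apply: qepi; rewrite comp1m ?compA tlunitE luniti_nat (tail2 (slide _ _)) /=.
have e := qbimod I X; rewrite /= in e.
have e' : q I X ∘ (R ◁ blact X) = q I X ∘ (amul R ▷ bcar X) ∘ associ R R (bcar X).
  by rewrite (tail e) ?compA associK compm1.
rewrite (tail e') ?compA (tail2 (associ_natl _)) (tail (whiskr _ _)) amul1l.
by rewrite (tail (lunit_tens' _ _)) lunitiK compm1.
Qed.

Lemma trunitK X : truniti X ∘ trunit X = idm (X ⊙ I).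
Proof.
apply: qepi; rewrite comp1m ?compA trunitE runiti_nat -(tail2 (slide _ _)) /=.
have e := qbimod X I; rewrite /= in e.
rewrite (tail e) ?compA (tail2 (assoc_natr _)) (tail (whiskl _ _)) amul1r.
by rewrite (tail (runit_tens _ _)) runitiK compm1.
Qed.

Lemma tlunitP X : is_bimodule_map (X := I ⊡ X) (Y := X) (tlunit X).
Proof.
split=> /=.
- apply: lqepi; rewrite ?compA tlactE whiskl tlunitE (tail (tlunitE X)) /=.
  by rewrite (tail (proj1 (blactP X))) ?compA associK compm1.
- apply: rqepi; rewrite ?compA tractE whiskr tlunitE (tail (tlunitE X)) /=.
  by rewrite bactA.
Qed.

Lemma trunitP X : is_bimodule_map (X := X ⊡ I) (Y := X) (trunit X).
Proof.
split=> /=.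
- apply: lqepi; rewrite ?compA tlactE whiskl trunitE (tail (trunitE X)) /=.
  by rewrite (tail (bactA X)) ?compA associK compm1.
- apply: rqepi; rewrite ?compA tractE whiskr trunitE (tail (trunitE X)) /=.
  by rewrite (proj1 (bractP X)).
Qed.

Definition blunit X : bimodule_hom R (I ⊡ X) X := exist _ (tlunit X) (tlunitP X).
Definition brunit X : bimodule_hom R (X ⊡ I) X := exist _ (trunit X) (trunitP X).

Definition bluniti X : bimodule_hom R X (I ⊡ X) :=
  exist _ (tluniti X)
    (bimodule_map_inv (X := I ⊡ X) (tlunitK X) (tlunitiK X) (tlunitP X)).
Definition bruniti X : bimodule_hom R X (X ⊡ I) :=
  exist _ (truniti X)
    (bimodule_map_inv (X := X ⊡ I) (trunitK X) (trunitiK X) (trunitP X)).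

Lemma tmap_id X Y (f : bimodule_hom R X X) (g : bimodule_hom R Y Y) :
  proj1_sig f = idm _ -> proj1_sig g = idm _ -> tmap f g = idm (X ⊙ Y).
Proof. by move=> ef eg; apply: qepi; rewrite tmapE ef eg tens1 compm1 comp1m. Qed.

Lemma sigma_nat M X Y M' X' Y' (f : bimodule_hom R M M') (g : bimodule_hom R X X')
    (h : bimodule_hom R Y Y') :
  sigma M' X' Y' ∘ tmap (bmap f g) h = tmap f (bmap g h) ∘ sigma M X Y.
Proof.
apply: qqlepi; rewrite ?compA sigmaE (tail (tmapE _ _)) ?compA /= comp_tens.
rewrite tmapE compm1 -[proj1_sig h]comp1m tensC (tail3k (sigmaE _ _ _)) ?compA.
rewrite assoc_nat (tail (tmapE f (bmap g h))) ?compA /= !(tail (comp_tens _ _ _ _)).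
by rewrite tmapE compm1 comp1m.
Qed.

Lemma tlunit_nat X Y (i : bimodule_hom R I I) (f : bimodule_hom R X Y) :
  proj1_sig i = idm _ -> tlunit Y ∘ tmap i f = proj1_sig f ∘ tlunit X.
Proof.
move=> ei; apply: qepi; rewrite ?compA tmapE tlunitE (tail (tlunitE Y)) ei.
by rewrite (proj1 (proj2_sig f)).
Qed.

Lemma trunit_nat X Y (f : bimodule_hom R X Y) (i : bimodule_hom R I I) :
  proj1_sig i = idm _ -> trunit Y ∘ tmap f i = proj1_sig f ∘ trunit X.
Proof.
move=> ei; apply: qepi; rewrite ?compA tmapE trunitE (tail (trunitE Y)) ei.
by rewrite (proj2 (proj2_sig f)).
Qed.

Lemma sigma_pentagon M X Y Z (i : bimodule_hom R M M) (j : bimodule_hom R Z Z) :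
  proj1_sig i = idm _ -> proj1_sig j = idm _ ->
  tmap i (bassoc X Y Z) ∘ sigma M (X ⊡ Y) Z ∘ tmap (bassoc M X Y) j
  = sigma M X (Y ⊡ Z) ∘ sigma (M ⊡ X) Y Z.
Proof.
move=> ei ej; apply: qqlepi.
have e : forall (z : C) (u v : hom (((M ⊙ X) ⊗ bcar Y) ⊗ bcar Z) z),
    u ∘ (q M X ▷ bcar Y ▷ bcar Z) = v ∘ (q M X ▷ bcar Y ▷ bcar Z) -> u = v.
  by move=> z u v; apply: rrqepi.
apply: e.
rewrite ?compA (tail3k (sigmaE (M ⊡ X) Y Z)) ?compA.
rewrite (tail (tmapE _ _)) ej /= ?compA !whiskr ?compA sigmaE.
rewrite -!whiskr (tail3k (sigmaE _ _ _)) ?compA.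
rewrite (tail (tmapE _ _)) ei /= ?compA.
rewrite (tail2 (assoc_nat _ _ _)) !(tail (whiskl _ _)) ?compA sigmaE.
rewrite assoc_natl -(tail2 (slide _ _)) (tail3k (sigmaE _ _ _)) ?compA.
by rewrite -!whiskl ?compA pentagon (tail2 (assoc_natr _)).
Qed.

Lemma sigma_triangle X Y (i : bimodule_hom R X X) (j : bimodule_hom R Y Y) :
  proj1_sig i = idm _ -> proj1_sig j = idm _ ->
  tmap i (blunit Y) ∘ sigma X I Y = tmap (brunit X) j.
Proof.
move=> ei ej; apply: qqlepi.
rewrite ?compA sigmaE (tail (tmapE i _)) ei /= ?compA (tail (whiskl _ _)) tlunitE.
rewrite (tail (tmapE _ _)) ej /= ?compA whiskr trunitE.
by rewrite qbimod.
Qed.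

(* Only coflatness is used here: since M ⊗ - preserves the coequalizer q X Y, the
   inverse of the associativity constraint is obtained without robustness. *)
Definition bimodule_moncat : monoidal_category.
Proof.
refine (@MonoidalCategory (bimodule_cat R) tens_bimod
  (fun X X' Y Y' f g => bmap f g) I bassoc bassoci blunit bluniti brunit bruniti
  _ _ _ _ _ _ _ _ _ _ _ _ _).
- by move=> X Y; apply: bimodule_hom_eq; apply: tmap_id.
- move=> X Y Z X' Y' Z' f g f' g'; apply: bimodule_hom_eq => /=; apply: qepi.
  by rewrite ?compA !tmapE (tail (tmapE _ _)) ?compA /= tensC.
- by move=> X Y Z; apply: bimodule_hom_eq; apply: sigmaK.
- by move=> X Y Z; apply: bimodule_hom_eq; apply: sigmaiK.
- by move=> X; apply: bimodule_hom_eq; apply: tlunitK.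
- by move=> X; apply: bimodule_hom_eq; apply: tlunitiK.
- by move=> X; apply: bimodule_hom_eq; apply: trunitK.
- by move=> X; apply: bimodule_hom_eq; apply: trunitiK.
- by move=> X Y Z X' Y' Z' f g h; apply: bimodule_hom_eq; apply: sigma_nat.
- by move=> X Y f; apply: bimodule_hom_eq; apply: tlunit_nat.
- by move=> X Y f; apply: bimodule_hom_eq; apply: trunit_nat.
- by move=> X Y Z T; apply: bimodule_hom_eq; apply: sigma_pentagon.
- by move=> X Y; apply: bimodule_hom_eq; apply: sigma_triangle.
Defined.

End BimoduleTensor.

Arguments bimodule_moncat {C} cq cf R.

(* Main.v *)
(** Over a Frobenius algebra [R] with Casimir element [e = e₁ ⊗ e₂] and counit [θ],
    the maps [X ⊗_R Y → X ⊗ Y], [x ⊗ y ↦ x e₁ ⊗ e₂ y], and [θ] make the forgetful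
    functor from [R]-bimodules to [C] Frobenius monoidal, so it preserves dual pairs.

    Conversely let [D] be a right dual of [X] in [C], with evaluation [ev]. Since
    [ψ ↦ e₁ ψ(e₂ -)] identifies maps [V → 𝟙] with left linear maps [V → R], the map
    [b(x, d) = e₁ ev(e₂ x, d)] makes [D] represent the left linear maps
    [X ⊗ - → R]. Hence [b(x, r d) = b(x r, d)] and [b(x, d r) = b(x, d) r] define a
    bimodule structure on [D]. Separability yields [a] with [e₁ a e₂ = 1], and
    [b] and [(1 ⊗ a) coev] descend to a dual pair over [R]. Left duals follow by
    reversing the tensor product. *)
From Stdlib Require Import ssreflect.
Require Import Defs.

Set Implicit Arguments.
Unset Strict Implicit.
Unset Printing Implicit Defensive.

(** * Coherence: maps extended by an object, with brackets nested to the right *)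

Section Extension.
Context {C : monoidal_category}.

(** Composites are kept nested to the right, so rewriting at their head needs the equation with an
    arbitrary tail [t]. *)
Lemma tail4 (a b c d d' z : C) (f : hom d d') (g : hom c d) (h : hom b c)
    (k : hom a b) (u : hom a d') :
  f ∘ g ∘ h ∘ k = u -> forall t : hom z a, f ∘ g ∘ h ∘ k ∘ t = u ∘ t.
Proof. by move=> <- t; rewrite !compA. Qed.

Implicit Types A B D P Q W Z : C.

(* Extensions by [Z] with all brackets nested to the right: written with them, the
   axioms of algebras and modules contain no associators. They are locked because
   ssreflect's matching would otherwise see the composites inside them. *)
Definition ext {A B D} (f : hom (A ⊗ B) D) Z : hom (A ⊗ (B ⊗ Z)) (D ⊗ Z) :=
  locked ((f ▷ Z) ∘ associ A B Z).
Definition coext {A B} (e : hom 𝟙 (A ⊗ B)) Z : hom Z (A ⊗ (B ⊗ Z)) :=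
  locked (assoc A B Z ∘ (e ▷ Z) ∘ luniti Z).
Definition uext {A} (t : hom A 𝟙) Z : hom (A ⊗ Z) Z := locked (lunit Z ∘ (t ▷ Z)).
Definition ucoext {A} (u : hom 𝟙 A) Z : hom Z (A ⊗ Z) :=
  locked ((u ▷ Z) ∘ luniti Z).

Lemma extE {A B D} (f : hom (A ⊗ B) D) Z : ext f Z = (f ▷ Z) ∘ associ A B Z.
Proof. by rewrite /ext -lock. Qed.

Lemma coextE {A B} (e : hom 𝟙 (A ⊗ B)) Z :
  coext e Z = assoc A B Z ∘ (e ▷ Z) ∘ luniti Z.
Proof. by rewrite /coext -lock. Qed.

Lemma uextE {A} (t : hom A 𝟙) Z : uext t Z = lunit Z ∘ (t ▷ Z).
Proof. by rewrite /uext -lock. Qed.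

Lemma ucoextE {A} (u : hom 𝟙 A) Z : ucoext u Z = (u ▷ Z) ∘ luniti Z.
Proof. by rewrite /ucoext -lock. Qed.

(** Kelly's argument: tensored with [𝟙], the two sides become [lunit (𝟙 ⊗ 𝟙)] and [𝟙 ◁ lunit 𝟙]
    after [assoc], and these agree by naturality of [lunit] at the isomorphism [lunit 𝟙]. *)
Lemma lunit1 : lunit 𝟙 = runit 𝟙 :> hom (𝟙 ⊗ 𝟙 : C) 𝟙.
Proof.
apply: runit_inj; rewrite -triangle -lunit_tens.
by congr (_ ∘ _); apply: (iso_mono (lunitK 𝟙)); rewrite lunit_nat.
Qed.

Lemma runiti1 : runiti 𝟙 = luniti 𝟙 :> hom 𝟙 (𝟙 ⊗ 𝟙 : C).
Proof. by apply: (iso_mono (lunitK 𝟙)); rewrite lunitiK lunit1 runitiK. Qed.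

Lemma runit_tens' A B : runit (A ⊗ B) ∘ associ A B 𝟙 = A ◁ runit B.
Proof. by rewrite -runit_tens compA associK compm1. Qed.

Lemma triangle' A B : (runit A ▷ B) ∘ associ A 𝟙 B = A ◁ lunit B.
Proof. by rewrite -triangle compA associK compm1. Qed.

Lemma triangle_inv A B : associ A 𝟙 B ∘ (A ◁ luniti B) = runiti A ▷ B.
Proof.
apply: (iso_mono (whiskr1 B (runitK A))).
by rewrite (tail (triangle' A B)) whiskl1 ?lunitiK // whiskr1 ?runitiK.
Qed.

Lemma luniti_tens A B : associ 𝟙 A B ∘ luniti (A ⊗ B) = luniti A ▷ B.
Proof.
apply: (iso_mono (whiskr1 B (lunitK A))).
by rewrite (tail (lunit_tens' A B)) lunitiK whiskr1 ?lunitiK.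
Qed.

Lemma luniti_tens' A B : assoc 𝟙 A B ∘ (luniti A ▷ B) = luniti (A ⊗ B).
Proof. by rewrite -luniti_tens (tail (associK _ _ _)) comp1m. Qed.

Lemma triangle_inv' A B : assoc A 𝟙 B ∘ (runiti A ▷ B) = A ◁ luniti B.
Proof. by rewrite -triangle_inv (tail (associK _ _ _)) comp1m. Qed.

Lemma runiti_tens A B : associ A B 𝟙 ∘ (A ◁ runiti B) = runiti (A ⊗ B).
Proof.
apply: (iso_mono (runitK (A ⊗ B))).
by rewrite (tail (runit_tens' A B)) runitiK whiskl1 ?runitiK.
Qed.

Lemma ext_nat {A B D Z W} (f : hom (A ⊗ B) D) (z : hom Z W) :
  ext f W ∘ (A ◁ (B ◁ z)) = (D ◁ z) ∘ ext f Z.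
Proof. by rewrite !extE !compA associ_natr (tail2 (slide _ _)). Qed.

Lemma coext_nat {A B Z W} (e : hom 𝟙 (A ⊗ B)) (z : hom Z W) :
  coext e W ∘ z = (A ◁ (B ◁ z)) ∘ coext e Z.
Proof.
by rewrite !coextE !compA luniti_nat (tail2 (slide _ _)) (tail2 (assoc_natr _)).
Qed.

Lemma uext_nat {A Z W} (t : hom A 𝟙) (z : hom Z W) :
  uext t W ∘ (A ◁ z) = z ∘ uext t Z.
Proof. by rewrite !uextE !compA slide (tail2 (lunit_nat _)). Qed.

Lemma ucoext_nat {A Z W} (u : hom 𝟙 A) (z : hom Z W) :
  ucoext u W ∘ z = (A ◁ z) ∘ ucoext u Z.
Proof. by rewrite !ucoextE !compA luniti_nat (tail2 (slide _ _)). Qed.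

Lemma ext_comp {A B D E} (f : hom (A ⊗ B) D) (g : hom D E) {Z : C} :
  ext (g ∘ f) Z = (g ▷ Z) ∘ ext f Z.
Proof. by rewrite !extE -whiskr !compA. Qed.

Lemma ext_whiskr {A B B' D} (f : hom (A ⊗ B') D) (g : hom B B') {Z : C} :
  ext f Z ∘ (A ◁ (g ▷ Z)) = ext (f ∘ (A ◁ g)) Z.
Proof. by rewrite !extE -whiskr !compA associ_nat. Qed.

Lemma ext_whiskl {A A' B D} (f : hom (A' ⊗ B) D) (g : hom A A') {Z : C} :
  ext f Z ∘ (g ▷ (B ⊗ Z)) = ext (f ∘ (g ▷ B)) Z.
Proof. by rewrite !extE -whiskr !compA associ_natl. Qed.

(** The hypothesis is the common shape of all associativity laws (algebra, left and right actions,
    their compatibility, linearity of a pairing); extension removes the associator. *)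
Lemma ext_ext {A B P Q D E} (f : hom (B ⊗ D) E) (g : hom (P ⊗ Q) B)
    (h : hom (P ⊗ A) E) (k : hom (Q ⊗ D) A) {Z : C} :
  f ∘ (g ▷ D) = h ∘ (P ◁ k) ∘ assoc P Q D ->
  ext f Z ∘ ext g (D ⊗ Z) = ext h Z ∘ (P ◁ ext k Z).
Proof.
move=> e; rewrite !extE !compA (tail2 (associ_natl _)) (tail (whiskr _ _)) e.
rewrite -!whiskr !compA (tail2 (pentB P Q D Z)) !compA associK compm1.
by rewrite -whiskl (tail2 (associ_nat _ _ _)).
Qed.

Lemma ext_assoc {A B D Z W} (f : hom (A ⊗ B) D) :
  ext f (Z ⊗ W) ∘ (A ◁ assoc B Z W)
  = assoc D Z W ∘ (ext f Z ▷ W) ∘ associ A (B ⊗ Z) W.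
Proof.
rewrite !extE compA -pentA -whiskr !compA.
by rewrite (tail2 (assoc_natl _)).
Qed.

Lemma ext_associ {A B D Z W} (f : hom (A ⊗ B) D) :
  (ext f Z ▷ W) ∘ associ A (B ⊗ Z) W ∘ (A ◁ associ B Z W)
  = associ D Z W ∘ ext f (Z ⊗ W).
Proof.
apply: (iso_epi (whiskl1 A (associK B Z W))).
rewrite !compA whiskl1 ?assocK // compm1 ext_assoc.
by rewrite (tail (assocK _ _ _)) comp1m.
Qed.

Lemma ext_assocC {A B D Z W} (f : hom (A ⊗ B) D) :
  ext f (Z ⊗ W) ∘ (A ◁ assoc B Z W) ∘ assoc A (B ⊗ Z) W
  = assoc D Z W ∘ (ext f Z ▷ W).
Proof. by rewrite (tail2 (ext_assoc f)) !compA assocK compm1. Qed.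

Lemma ext_runit {A B D} (f : hom (A ⊗ B) D) :
  runit D ∘ ext f 𝟙 = f ∘ (A ◁ runit B).
Proof. by rewrite !extE (tail2 (runit_nat f)) runit_tens'. Qed.

Lemma ext_runiti {A B D} (f : hom (A ⊗ B) D) :
  ext f 𝟙 ∘ (A ◁ runiti B) = runiti D ∘ f.
Proof. by rewrite !extE compA runiti_tens runiti_nat. Qed.

Lemma ext_ucoextl {A B D} (f : hom (A ⊗ B) D) (u : hom 𝟙 A) {Z : C} :
  ext f Z ∘ ucoext u (B ⊗ Z) = (f ∘ ucoext u B) ▷ Z.
Proof.
by rewrite !extE !ucoextE -!whiskr !compA (tail2 (associ_natl _)) luniti_tens.
Qed.

Lemma ext_ucoextr {A B D} (f : hom (A ⊗ B) D) (u : hom 𝟙 B) {Z : C} :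
  ext f Z ∘ (A ◁ ucoext u Z) = (f ∘ (A ◁ u) ∘ runiti A) ▷ Z.
Proof.
rewrite !extE !ucoextE -!whiskr -!whiskl !compA (tail2 (associ_nat _ _ _)).
by rewrite triangle_inv.
Qed.

Lemma assoc_ext {A B D Z} (f : hom (A ⊗ B) D) :
  ext f Z ∘ assoc A B Z = f ▷ Z.
Proof. by rewrite !extE compA assocK compm1. Qed.

Lemma coext_assoc {A B Z W} (e : hom 𝟙 (A ⊗ B)) :
  (A ◁ assoc B Z W) ∘ assoc A (B ⊗ Z) W ∘ (coext e Z ▷ W) = coext e (Z ⊗ W).
Proof.
rewrite !coextE -!whiskr (tail3 (pentagon A B Z W)).
by rewrite (tail2 (assoc_natl _)) luniti_tens'.
Qed.

Lemma assoc_coext {A B Z W} (e : hom 𝟙 (A ⊗ B)) :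
  assoc A (B ⊗ Z) W ∘ (coext e Z ▷ W) = (A ◁ associ B Z W) ∘ coext e (Z ⊗ W).
Proof.
by rewrite -coext_assoc (tail (whiskl1 A (assocK _ _ _))) comp1m.
Qed.

End Extension.

(** * Right duals in [C] and transposition along the evaluation *)

Section Duality.
Context {C : monoidal_category} {X D : C}.
Context {ev : hom (X ⊗ D) 𝟙} {co : hom 𝟙 (D ⊗ X)} (dual : is_right_dual ev co).
Implicit Types W Z : C.

Lemma ev_nat W Z (z : hom Z W) :
  lunit W ∘ ext ev W ∘ (X ◁ (D ◁ z)) = z ∘ lunit Z ∘ ext ev Z.
Proof. by rewrite ext_nat (tail2 (lunit_nat z)). Qed.

Lemma ev_assoc Z W :
  lunit (Z ⊗ W) ∘ ext ev (Z ⊗ W) ∘ (X ◁ assoc D Z W)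
  = ((lunit Z ∘ ext ev Z) ▷ W) ∘ associ X (D ⊗ Z) W.
Proof. by rewrite ext_assoc (tail (lunit_tens _ _)) -!whiskr !compA. Qed.

Lemma dual_zig Z :
  lunit (X ⊗ Z) ∘ ext ev (X ⊗ Z) ∘ (X ◁ coext co Z) = idm (X ⊗ Z).
Proof.
have [h _] := dual.
rewrite coextE -!whiskl (tail3 (ev_assoc X Z)) ?compA (tail2 (associ_nat _ _ _)).
by rewrite triangle_inv !whiskr extE !compA h tens1.
Qed.

Lemma dual_zig1 : lunit X ∘ ext ev X ∘ (X ◁ co) ∘ runiti X = idm X.
Proof. by rewrite extE !compA (proj1 dual). Qed.

Lemma dual_zag Z :
  (D ◁ (lunit Z ∘ ext ev Z)) ∘ coext co (D ⊗ Z) = idm (D ⊗ Z).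
Proof.
have [_ h] := dual.
rewrite extE coextE -!whiskl !compA.
have e : (D ◁ associ X D Z) ∘ assoc D X (D ⊗ Z)
    = assoc D (X ⊗ D) Z ∘ (assoc D X D ▷ Z) ∘ associ (D ⊗ X) D Z.
  by rewrite pentB (tail (associK _ _ _)) comp1m.
rewrite (tail2 e) !compA -(tail2 (assoc_nat _ _ _)) (tail (triangle _ _)).
rewrite (tail2 (associ_natl _)) luniti_tens.
by rewrite !whiskr h tens1.
Qed.

(** By [dual_zag], a map into [D ⊗ Z] is recovered from its transpose by inserting [co]. *)
Lemma dual_inj W Z (u v : hom W (D ⊗ Z)) :
  lunit Z ∘ ext ev Z ∘ (X ◁ u) = lunit Z ∘ ext ev Z ∘ (X ◁ v) -> u = v.
Proof.
have E : forall w : hom W (D ⊗ Z),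
    w = (D ◁ (lunit Z ∘ ext ev Z ∘ (X ◁ w))) ∘ coext co W.
  move=> w; rewrite -[LHS]comp1m -(dual_zag Z) !compA coext_nat.
  by rewrite (tail (whiskl _ _)) !compA.
by move=> h; rewrite (E u) (E v) h.
Qed.

Lemma dual_inj1 W (u v : hom W D) : ev ∘ (X ◁ u) = ev ∘ (X ◁ v) -> u = v.
Proof.
move=> h; apply: (iso_mono (runitiK D)); apply: dual_inj.
by rewrite -!whiskl !(tail (ext_runiti _)) !compA h.
Qed.

Lemma dual_transpose W (psi : hom (X ⊗ W) 𝟙) :
  exists u : hom W D, ev ∘ (X ◁ u) = psi.
Proof.
(* Insert [co], then apply [psi] to the factor [X ⊗ W]; [dual_zig] returns [psi]. *)
exists (runit D ∘ (D ◁ psi) ∘ coext co W).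
rewrite -!whiskl (tail2 (eq_sym (ext_runit ev))) -lunit1 (tail3 (ev_nat psi)).
by rewrite !compA dual_zig compm1.
Qed.

End Duality.

(** * Module axioms in associator-free form *)

Section Actions.
Context {C : monoidal_category} {R : algebra C}.

Lemma lactionA (Y : C) (mu : hom (R ⊗ Y) Y) :
  is_laction mu -> mu ∘ ext (amul R) Y = mu ∘ (R ◁ mu).
Proof. by case=> e _; rewrite extE (tail e) !compA associK compm1. Qed.

Lemma laction1 (Y : C) (mu : hom (R ⊗ Y) Y) :
  is_laction mu -> mu ∘ ucoext (aone R) Y = idm Y.
Proof. by case=> _ e; rewrite ucoextE (tail e) lunitiK. Qed.

Lemma ext_laction (Y W : C) (mu : hom (R ⊗ Y) Y) :
  is_laction mu -> is_laction (ext mu W).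
Proof.
move=> h; have [muA mu1] := h; split.
- by rewrite -assoc_ext (tail (ext_ext (Z := W) muA)) !compA.
- rewrite extE compA associ_natl (tail (whiskr _ _)) mu1.
  by rewrite lunit_tens'.
Qed.

Lemma ractionA (X : C) (nu : hom (X ⊗ R) X) :
  is_raction nu -> nu ∘ ext nu R = nu ∘ (X ◁ amul R).
Proof. by case=> e _; rewrite extE (tail e) !compA associK compm1. Qed.

Lemma raction_ext (X W : C) (nu : hom (X ⊗ R) X) : is_raction nu ->
  ext nu W ∘ ext nu (R ⊗ W) = ext nu W ∘ (X ◁ ext (amul R) W).
Proof. by case=> e _; apply: ext_ext. Qed.

Lemma bact_ext (X : bimodule R) W :
  ext (bract X) W ∘ ext (blact X) (R ⊗ W)
  = ext (blact X) W ∘ (R ◁ ext (bract X) W).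
Proof. exact/ext_ext/bactA. Qed.

End Actions.

(* The equations that [q ∘ c] and the descent of [b] must satisfy for [D] to be a
   right dual of [X] over [R], required before passing to the quotients
   [X ⊗_R D] and [D ⊗_R X]. *)
Record dual_pairing {C : monoidal_category} {R : algebra C} (X D : bimodule R)
    (b : hom (bcar X ⊗ bcar D) R) (c : hom 𝟙 (bcar D ⊗ bcar X)) : Prop :=
  DualPairing {
    pairing_bal : b ∘ (bract X ▷ bcar D)
      = b ∘ (bcar X ◁ blact D) ∘ assoc (bcar X) R (bcar D);
    pairing_l : b ∘ (blact X ▷ bcar D)
      = amul R ∘ (R ◁ b) ∘ assoc R (bcar X) (bcar D);
    pairing_r : b ∘ (bcar X ◁ bract D) ∘ assoc (bcar X) (bcar D) R
      = amul R ∘ (b ▷ R);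
    copairing_central :
      (blact D ▷ bcar X) ∘ associ R (bcar D) (bcar X) ∘ (R ◁ c) ∘ runiti R
      = (bcar D ◁ bract X) ∘ assoc (bcar D) (bcar X) R ∘ (c ▷ R) ∘ luniti R;
    pairing_zig : blact X ∘ (b ▷ bcar X) ∘ associ (bcar X) (bcar D) (bcar X)
      ∘ (bcar X ◁ c) ∘ runiti (bcar X) = idm (bcar X);
    pairing_zag : bract D ∘ (bcar D ◁ b) ∘ assoc (bcar D) (bcar X) (bcar D)
      ∘ (c ▷ bcar D) ∘ luniti (bcar D) = idm (bcar D) }.

(** * Frobenius algebras: the Casimir element and linear maps into [R] *)

Section Frobenius.
Context {C : monoidal_category} {R : algebra C}.
Context {th : hom R 𝟙} {e : hom 𝟙 (R ⊗ R)}.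
Local Notation m := (amul R).
Context (frob : (m ▷ R) ∘ associ R R R ∘ (R ◁ e) ∘ runiti R
                = (R ◁ m) ∘ assoc R R R ∘ (e ▷ R) ∘ luniti R)
        (the : lunit R ∘ (th ▷ R) ∘ e = aone R)
        (eth : runit R ∘ (R ◁ th) ∘ e = aone R).

(** Centrality [r e₁ ⊗ e₂ ⊗ z = e₁ ⊗ e₂ r ⊗ z]: this is [frob] tensored with [Z]. *)
Lemma casimir Z :
  ext m (R ⊗ Z) ∘ (R ◁ coext e Z) = (R ◁ ext m Z) ∘ coext e (R ⊗ Z).
Proof.
have -> : ext m (R ⊗ Z) ∘ (R ◁ coext e Z)
    = assoc R R Z ∘ (((m ▷ R) ∘ associ R R R ∘ (R ◁ e) ∘ runiti R) ▷ Z).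
  rewrite coextE -!whiskl (tail2 (ext_assoc m)) !compA extE -!whiskr !compA.
  by rewrite (tail2 (associ_nat _ _ _)) triangle_inv.
rewrite frob -!whiskr (tail2 (assoc_nat _ _ _)).
rewrite (tail2 (eq_sym (pentD _ _ _ _))) !compA (tail2 (assoc_natl _)).
by rewrite luniti_tens' (tail (whiskl _ _)) -extE coextE.
Qed.

Lemma casimir_counitl Z :
  uext th (R ⊗ Z) ∘ coext e Z = ucoext (aone R) Z.
Proof.
rewrite uextE coextE ucoextE -the -!whiskr !compA -(tail2 (assoc_natl _)).
by rewrite (tail (lunit_tens _ _)).
Qed.

(** Elementwise [θ(r e₁) e₂ = θ(e₁) e₂ r = r]; the next lemma is the mirror
    [e₁ θ(e₂ r) = r e₁ θ(e₂) = r]. *)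
Lemma counit_mul_casimir Z :
  uext th (R ⊗ Z) ∘ ext m (R ⊗ Z) ∘ (R ◁ coext e Z) = idm (R ⊗ Z).
Proof.
rewrite casimir (tail2 (uext_nat _ _)) casimir_counitl ext_ucoextl.
by rewrite (laction1 (reg_lactP R)) tens1.
Qed.

Lemma mul_casimir_counit : runit R ∘ (R ◁ th) ∘ (R ◁ m) ∘ coext e R = idm R.
Proof.
rewrite coextE -frob (tail2 (eq_sym (slide _ _))) (tail2 (runit_nat _)).
rewrite -(tail2 (associ_natr th)) (tail (runit_tens' _ _)) !(tail (whiskl _ _)) !compA.
by rewrite eth (tail (amul1r R)) runitiK.
Qed.

(* [frob_hom ψ v = e₁ ψ(e₂ v)]: the inverse of [θ ∘ -] from left linear maps
   [V → R] to maps [V → 𝟙]. *)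
Definition frob_hom (V : C) (al : hom (R ⊗ V) V) (psi : hom V 𝟙) : hom V R :=
  locked (runit R ∘ (R ◁ (psi ∘ al)) ∘ coext e V).

Lemma frob_homE V al psi :
  @frob_hom V al psi = runit R ∘ (R ◁ (psi ∘ al)) ∘ coext e V.
Proof. by rewrite /frob_hom -lock. Qed.

Section Hom.
Context {V : C} {al : hom (R ⊗ V) V} (alP : is_laction al).

(** Centrality of [e]: [e₁ ψ(e₂ r v) = r e₁ ψ(e₂ v)]. *)
Lemma frob_hom_linear psi :
  frob_hom al psi ∘ al = m ∘ (R ◁ frob_hom al psi).
Proof.
rewrite frob_homE !compA coext_nat (tail (whiskl _ _)) compA -(lactionA alP).
rewrite -!whiskl (tail2 (eq_sym (ext_runit m))) !compA !(tail2 (ext_nat m _)) casimir.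
by [].
Qed.

Lemma counit_frob_hom psi : th ∘ frob_hom al psi = psi.
Proof.
rewrite frob_homE (tail2 (eq_sym (runit_nat th))) -lunit1 (tail (eq_sym (uextE th 𝟙))).
rewrite (tail2 (uext_nat _ _)) casimir_counitl compA (laction1 alP).
by rewrite compm1.
Qed.

(** Elementwise [e₁ θ(φ(e₂ v)) = e₁ θ(e₂ φ(v)) = φ(v)]. *)
Lemma frob_hom_counit phi :
  phi ∘ al = m ∘ (R ◁ phi) -> frob_hom al (th ∘ phi) = phi.
Proof.
move=> h; rewrite frob_homE compA h -!whiskl !compA -coext_nat.
by have := f_equal (fun g => g ∘ phi) mul_casimir_counit; rewrite !compA comp1m.
Qed.

Lemma linear_inj (phi phi' : hom V R) :
  phi ∘ al = m ∘ (R ◁ phi) -> phi' ∘ al = m ∘ (R ◁ phi') ->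
  th ∘ phi = th ∘ phi' -> phi = phi'.
Proof. by move=> h h' et; rewrite -(frob_hom_counit h) et frob_hom_counit. Qed.

End Hom.

(** * Normalizing the Casimir element by separability *)

Section SeparabilityElement.
Context {gam : hom R (R ⊗ R)}.
Context (gamP : is_bimodule_map (X := reg_bimod R) (Y := sq_bimod R) gam)
        (mgam : m ∘ gam = idm R).

(* [a = f₁ θ(f₂)] where [f = γ(1)]; it satisfies [e₁ a e₂ = 1]. *)
Definition sep_elt : hom 𝟙 R := runit R ∘ (R ◁ th) ∘ gam ∘ aone R.

(** Left linearity of [gam] gives [r a = (1 ⊗ θ) γ(r)], right linearity gives [γ(r) = f₁ ⊗ f₂ r].
    Hence [e₁ a e₂ = f₁ θ(f₂ e₁) e₂ = f₁ f₂ = 1]. *)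
Lemma casimir_sep_elt : m ∘ (R ◁ (m ∘ ucoext sep_elt R)) ∘ e = aone R.
Proof.
have [gaml gamr] := gamP; rewrite /= in gaml gamr.
have mulr1 : m ∘ (R ◁ aone R) ∘ runiti R = idm R by rewrite (tail (amul1r R)) runitiK.
have et : m ∘ (R ◁ sep_elt) ∘ runiti R = runit R ∘ (R ◁ th) ∘ gam.
  rewrite /sep_elt -!whiskl ?compA (tail2 (eq_sym (ext_runit m))) ?compA.
  rewrite (tail2 (ext_nat m th)) extE ?compA.
  rewrite (tail3 (eq_trans (eq_sym (compA _ _ _)) (eq_sym gaml))) ?compA.
  by rewrite mulr1 compm1.
have E1 : m ∘ (R ◁ (m ∘ ucoext sep_elt R))
    = m ∘ (R ◁ uext th R) ∘ assoc R R R ∘ (gam ▷ R).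
  rewrite -whiskl (tail2 (eq_sym (lactionA (reg_lactP R)))) ext_ucoextr et.
  by rewrite -!whiskr uextE -!whiskl ?compA -(tail2 (assoc_nat _ _ _)) (tail (triangle _ _)).
set f := gam ∘ aone R.
have gamf : gam = (R ◁ m) ∘ coext f R.
  rewrite coextE /f -!whiskr ?compA.
  rewrite (tail3 (eq_trans (eq_sym (compA _ _ _)) (eq_sym gamr))) ?compA.
  by rewrite -(ucoextE (aone R)) (laction1 (reg_lactP R)) compm1.
have E2 : assoc R R R ∘ (gam ▷ R) = (R ◁ ext m R) ∘ coext f (R ⊗ R).
  rewrite {1}gamf -whiskr (tail2 (assoc_nat _ _ _)) assoc_coext (tail (whiskl _ _)).
  by rewrite extE.
have s1 : uext th R ∘ ext m R ∘ (R ◁ e) = runit R.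
  apply: (iso_epi (runitK R)).
  by rewrite extE ?compA frob -coextE (tail2 (uext_nat th m)) ?compA casimir_counitl
    (laction1 (reg_lactP R)) runitiK.
rewrite (tail E1) ?compA (tail E2) ?compA coext_nat !(tail (whiskl _ _)) ?compA s1.
rewrite coextE (tail (runit_tens _ _)) (tail2 (runit_nat f)) -runiti1 runitiK compm1.
by rewrite /f (tail mgam) comp1m.
Qed.

End SeparabilityElement.

(** * The bimodule structure on a right dual in [C] and its pairing with [X] *)

Section DualBimodule.
Context {X : bimodule R} {D : C} {ev : hom (bcar X ⊗ D) 𝟙} {co : hom 𝟙 (D ⊗ bcar X)}.
Context (dual : is_right_dual ev co).

Local Notation l := (blact X).
Local Notation r := (bract X).

Definition pairing : hom (bcar X ⊗ D) R := frob_hom (ext l D) ev.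

Lemma pairing_linear : pairing ∘ ext l D = m ∘ (R ◁ pairing).
Proof. exact/frob_hom_linear/ext_laction/blactP. Qed.

Lemma counit_pairing : th ∘ pairing = ev.
Proof. exact/counit_frob_hom/ext_laction/blactP. Qed.

Lemma pairing_inj W (u v : hom W D) :
  pairing ∘ (bcar X ◁ u) = pairing ∘ (bcar X ◁ v) -> u = v.
Proof.
move=> h; apply: (dual_inj1 dual).
by rewrite -counit_pairing !compA h.
Qed.

Lemma pairing_whisk_linear W (u : hom W D) :
  pairing ∘ (bcar X ◁ u) ∘ ext l W = m ∘ (R ◁ (pairing ∘ (bcar X ◁ u))).
Proof.
by rewrite -(ext_nat l u) (tail pairing_linear) ?compA whiskl.
Qed.

(* Since [R] is Frobenius, [D] represents the left linear maps [X ⊗ - → R]. *)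
Lemma pairing_rep W (phi : hom (bcar X ⊗ W) R) :
  phi ∘ ext l W = m ∘ (R ◁ phi) -> exists u : hom W D, pairing ∘ (bcar X ◁ u) = phi.
Proof.
move=> h; have [u hu] := dual_transpose dual (th ∘ phi).
exists u; apply: (linear_inj _ h); first by rewrite compA pairing_whisk_linear.
by rewrite -hu -counit_pairing !compA.
Qed.

Lemma ext_pairing Z :
  ext pairing Z
  = (R ◁ (lunit Z ∘ ext ev Z ∘ ext l (D ⊗ Z))) ∘ coext e (bcar X ⊗ (D ⊗ Z)).
Proof.
rewrite (extE pairing) /pairing frob_homE -!whiskr ?compA -triangle ?compA.
rewrite (tail2 (assoc_nat _ _ _)) (tail2 (assoc_coext e)) ?compA coext_nat.
rewrite !(tail (whiskl _ _)) ?compA -whiskr ?compA ext_associ.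
by rewrite (extE ev) ?compA.
Qed.

(** [pairing_rep] gives the actions on [D] by mere existence, so they enter as variables fixed by
    their equations against the pairing. *)
Context {lam : hom (R ⊗ D) D} {rho : hom (D ⊗ R) D}.
Context (lamE : pairing ∘ (bcar X ◁ lam) = pairing ∘ ext r D)
        (rhoE : pairing ∘ (bcar X ◁ rho) = m ∘ ext pairing R).

Lemma ext_pairing_linear Z :
  ext pairing Z ∘ ext l (D ⊗ Z) = ext m Z ∘ (R ◁ ext pairing Z).
Proof.
apply: ext_ext.
by rewrite -assoc_ext (tail pairing_linear) ?compA.
Qed.

(** Tested against the pairing by [pairing_inj], the axioms of [lam] become the right module axioms
    of [X]; those of [rho] below become the axioms of the algebra [R]. *)
Lemma lam_laction : is_laction lam.
Proof.
split.
- rewrite -assoc_ext -(compA _ (R ◁ lam)) -compA; congr (_ ∘ _).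
  apply: pairing_inj; rewrite -!whiskl !(tail lamE) ?compA ext_nat (tail lamE).
  by rewrite ?compA (raction_ext _ (bractP X)).
- apply: pairing_inj; rewrite -!whiskl (tail lamE) ?compA.
  by rewrite ext_whiskr (proj2 (bractP X)) extE triangle'.
Qed.

Lemma rho_raction : is_raction rho.
Proof.
split; apply: pairing_inj; rewrite -!whiskl !(tail rhoE) ?compA.
- rewrite ext_whiskr rhoE ext_comp (tail2 (ext_nat pairing m)) ext_assoc.
  by rewrite (tail (amulA R)) extE ?compA.
- by rewrite (ext_nat pairing) (tail (amul1r R)) ext_runit.
Qed.

Lemma lam_rho : rho ∘ (lam ▷ R) = lam ∘ (R ◁ rho) ∘ assoc R D R.
Proof.
apply: pairing_inj; rewrite -!whiskl !(tail rhoE) (tail lamE) ?compA.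
rewrite (tail2 (ext_nat r rho)) (tail rhoE) ?compA ext_whiskr lamE ext_comp.
rewrite ext_assoc (tail (assoc_ext _)).
by rewrite extE.
Qed.

Definition dual_bimod : bimodule R := Bimodule lam_laction rho_raction lam_rho.

Context {a : hom 𝟙 R} (ea : m ∘ (R ◁ (m ∘ ucoext a R)) ∘ e = aone R).

Definition copairing : hom 𝟙 (D ⊗ bcar X) :=
  locked ((D ◁ (l ∘ ucoext a (bcar X))) ∘ co).

Lemma copairingE : copairing = (D ◁ (l ∘ ucoext a (bcar X))) ∘ co.
Proof. by rewrite /copairing -lock. Qed.

Lemma ev_copairing :
  lunit (bcar X) ∘ ext ev (bcar X) ∘ (bcar X ◁ copairing) ∘ runiti (bcar X)
  = l ∘ ucoext a (bcar X).
Proof.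
by rewrite copairingE -whiskl ?compA (tail3 (ev_nat _)) ?compA (dual_zig1 dual) compm1.
Qed.

(** Write [co = dᵢ ⊗ xᵢ]. Applying [ev(x, -)] to the first factor of [r dᵢ ⊗ a xᵢ] gives [a (x r)],
    and to that of [dᵢ ⊗ a xᵢ r] gives [(a x) r]; these agree in a bimodule. *)
Lemma dual_bimod_central :
  (lam ▷ bcar X) ∘ associ R D (bcar X) ∘ (R ◁ copairing) ∘ runiti R
  = (D ◁ r) ∘ assoc D (bcar X) R ∘ (copairing ▷ R) ∘ luniti R.
Proof.
have evlam : ev ∘ (bcar X ◁ lam) = ev ∘ ext r D.
  by rewrite -counit_pairing ?compA lamE.
apply: (dual_inj dual); rewrite -!whiskl.
rewrite (tail (ext_whiskr _ _)) evlam ext_comp (extE (ext r D)) ?compA.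
rewrite (tail3 (ext_associ r)) ?compA (tail (eq_sym (extE ev _))).
rewrite (tail2 (ext_nat r copairing)) ext_runiti.
rewrite (tail3 (ev_nat r)) ?compA (tail3 (ev_assoc _ _)) ?compA.
rewrite (tail2 (associ_nat _ _ _)) triangle_inv !whiskr ?compA ev_copairing.
rewrite (tail4 ev_copairing) ?compA -ext_ucoextl.
have rl : r ∘ ext l R = l ∘ (R ◁ r) by rewrite extE (tail (bactA X)) ?compA associK compm1.
by rewrite (tail rl) ?compA ucoext_nat.
Qed.

(** Elementwise [b(x, dᵢ) ⊗ xᵢ = e₁ ⊗ ev(e₂ x, dᵢ) xᵢ = e₁ ⊗ e₂ x]. *)
Lemma pairing_coev :
  ext pairing (bcar X) ∘ (bcar X ◁ co) ∘ runiti (bcar X) = (R ◁ l) ∘ coext e (bcar X).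
Proof.
rewrite ext_pairing ?compA (tail2 (coext_nat _ _)) coext_nat.
rewrite !(tail (whiskl _ _)) ?compA (tail2 (ext_nat l co)) ext_runiti.
by rewrite (tail4 (dual_zig1 dual)) comp1m.
Qed.

(** Elementwise [b(x, dᵢ) a xᵢ = e₁ a e₂ x = x]; this is where [a] is needed. *)
Lemma dual_bimod_zig :
  l ∘ (pairing ▷ bcar X) ∘ associ (bcar X) D (bcar X)
    ∘ (bcar X ◁ copairing) ∘ runiti (bcar X) = idm (bcar X).
Proof.
have ll : l ∘ (R ◁ (l ∘ ucoext a (bcar X) ∘ l))
    = l ∘ ext (m ∘ (R ◁ (m ∘ ucoext a R))) (bcar X).
  rewrite ucoext_nat (tail (eq_sym (lactionA (blactP X)))) ?compA ext_ucoextl.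
  by rewrite -whiskl (tail (eq_sym (lactionA (blactP X)))) ?compA ext_whiskr.
rewrite (tail (eq_sym (extE _ _))) copairingE -whiskl ?compA (tail2 (ext_nat pairing _)).
rewrite pairing_coev (tail (whiskl _ _)) ?compA (tail ll) coextE ?compA.
rewrite (tail (assoc_ext _)) (tail (whiskr _ _)) ?compA ea -(ucoextE (aone R)).
by rewrite (laction1 (blactP X)).
Qed.

(** Against the pairing, [b(x, dᵢ b(a xᵢ, d)) = b(x, dᵢ) b(a xᵢ, d) = b(b(x, dᵢ) a xᵢ, d)], which is
    [b(x, d)] by the zig identity. *)
Lemma dual_bimod_zag :
  rho ∘ (D ◁ pairing) ∘ assoc D (bcar X) D ∘ (copairing ▷ D) ∘ luniti D = idm D.
Proof.
have z := dual_bimod_zig; rewrite (tail (eq_sym (extE pairing _))) in z.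
apply: pairing_inj; rewrite -!whiskl (tail rhoE) ?compA (tail2 (ext_nat pairing _)).
rewrite (tail2 (eq_sym pairing_linear)) (tail2 (ext_assoc pairing)) ?compA.
rewrite (tail (assoc_ext l)) (tail2 (associ_nat _ _ _)) triangle_inv !whiskr ?compA.
by rewrite z !tens1.
Qed.

Lemma dual_bimod_pairing : dual_pairing (X := X) (D := dual_bimod) pairing copairing.
Proof.
split=> /=.
- by rewrite -assoc_ext (tail lamE) ?compA.
- by rewrite -assoc_ext (tail pairing_linear) ?compA.
- by rewrite (tail rhoE) ?compA assoc_ext.
- exact: dual_bimod_central.
- exact: dual_bimod_zig.
- exact: dual_bimod_zag.
Qed.

End DualBimodule.

End Frobenius.

Lemma dual_pairing_exists (C : monoidal_category) (R : algebra C) (X : bimodule R) :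
  frobenius R -> separable R -> has_right_dual (bcar X) ->
  exists (D : bimodule R) (b : hom (bcar X ⊗ bcar D) R) (c : hom 𝟙 (bcar D ⊗ bcar X)),
    dual_pairing b c.
Proof.
case=> th [e [frob [the eth]]] [gam [gamP mgam]] [D [ev [co dual]]].
set p := pairing (e := e) (ev := ev) (X := X).
have pl : p ∘ ext (blact X) D = amul R ∘ (R ◁ p) by exact: pairing_linear.
(* The map [b(x r, d)] is left linear in [x] because the two actions on [X] commute. *)
have [|lam lamE] := pairing_rep frob the eth dual (phi := p ∘ ext (bract X) D).
  by rewrite compA bact_ext (tail pl) -whiskl compA.
(* The map [b(x, d) r] is left linear in [x] by associativity of [R]. *)
have [|rho rhoE] := pairing_rep frob the eth dual (phi := amul R ∘ ext p R).
  rewrite compA ext_pairing_linear // (tail (lactionA (reg_lactP R))).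
  by rewrite -whiskl compA.
exists (dual_bimod the dual lamE rhoE), p,
  (copairing (X := X) (co := co) (a := sep_elt (th := th) (gam := gam))).
exact/dual_bimod_pairing/casimir_sep_elt.
Qed.

(** * Right duals over [R] in terms of morphisms of [C] *)

Section OverR.
Context {C : monoidal_category} {cq : coequalizers C} {cf : forall X : C, coflat X}.
Context {R : algebra C}.
Implicit Types X Y D : bimodule R.

Local Notation q X Y := (qmap cq (bimod_r X) (bimod_l Y)).
Local Notation "X ⊙ Y" := (tens_over cq (bimod_r X) (bimod_l Y))
  (at level 34, left associativity).
Local Notation "X ⊡ Y" := (tens_bimod cq cf X Y) (at level 34, left associativity).
Local Notation I := (reg_bimod R).
Local Notation m := (amul R).
Local Notation id_ X := (idm (X : bimodule_cat R)).

Lemma sigma_q M X Y : sigma cq cf M X Y ∘ q (M ⊡ X) Y = sigma0 cq cf M X Y.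
Proof. exact: coeq_descE. Qed.

Lemma sigmai_q M X Y : sigmai cq cf M X Y ∘ q M (X ⊡ Y) = sigmai0 cq cf M X Y.
Proof. exact: coeq_descE. Qed.

(** The inverse unit constraints insert [aone R], so [coev] enters only through its value at [1],
    and the associativity constraints can be replaced by [sigmai0] and [sigma0], which live before
    the outer quotient. *)
Lemma right_dual_over X D (ev : bimodule_hom R (X ⊡ D) I)
    (coev : bimodule_hom R I (D ⊡ X)) :
  is_right_dual (C := bimodule_moncat cq cf R) ev coev <->
  (tlunit cq X ∘ tmap cq ev (id_ X) ∘ sigmai0 cq cf X D X
     ∘ (bcar X ◁ (proj1_sig coev ∘ aone R)) ∘ runiti (bcar X) = idm (bcar X)
   /\ trunit cq D ∘ tmap cq (id_ D) ev ∘ sigma0 cq cf D X D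
     ∘ ((proj1_sig coev ∘ aone R) ▷ bcar D) ∘ luniti (bcar D) = idm (bcar D)).
Proof.
have e1 : tlunit cq X ∘ tmap cq ev (id_ X) ∘ sigmai cq cf X D X
      ∘ tmap cq (id_ X) coev ∘ truniti cq X
    = tlunit cq X ∘ tmap cq ev (id_ X) ∘ sigmai0 cq cf X D X
      ∘ (bcar X ◁ (proj1_sig coev ∘ aone R)) ∘ runiti (bcar X).
  rewrite /truniti (tail (tmapE cq (id_ X) coev)) ?compA.
  by rewrite (tail (sigmai_q _ _ _)) (tail (whiskl _ _)).
have e2 : trunit cq D ∘ tmap cq (id_ D) ev ∘ sigma cq cf D X D
      ∘ tmap cq coev (id_ D) ∘ tluniti cq D
    = trunit cq D ∘ tmap cq (id_ D) ev ∘ sigma0 cq cf D X D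
      ∘ ((proj1_sig coev ∘ aone R) ▷ bcar D) ∘ luniti (bcar D).
  rewrite /tluniti (tail (tmapE cq coev (id_ D))) ?compA.
  by rewrite (tail (sigma_q _ _ _)) (tail (whiskr _ _)).
rewrite -e1 -e2; split.
- by case=> h1 h2; split;
    [have := f_equal (@proj1_sig _ _) h1 | have := f_equal (@proj1_sig _ _) h2].
- by case=> h1 h2; split; apply: bimodule_hom_eq.
Qed.

(** * From a pairing to a right dual over [R] *)

Section FromPairing.
Context {X D : bimodule R} {b : hom (bcar X ⊗ bcar D) R} {c : hom 𝟙 (bcar D ⊗ bcar X)}.
Context (bc : dual_pairing b c).

Definition ev_over : hom (X ⊙ D) R :=
  coeq_desc (qmapP cq (bimod_r X) (bimod_l D)) (pairing_bal bc).

Lemma ev_overE : ev_over ∘ q X D = b.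
Proof. exact: coeq_descE. Qed.

Lemma ev_over_bimod : is_bimodule_map (X := X ⊡ D) (Y := I) ev_over.
Proof.
split=> /=.
- apply: (lqepi cf); rewrite ?compA tlactE whiskl ev_overE (tail ev_overE).
  by rewrite (tail (pairing_l bc)) ?compA associK compm1.
- apply: (rqepi cf); rewrite ?compA tractE whiskr ev_overE (tail ev_overE).
  exact: pairing_r bc.
Qed.

Definition coev_over : hom R (D ⊙ X) :=
  q D X ∘ ext (blact D) (bcar X) ∘ (R ◁ c) ∘ runiti R.

(** Centrality turns [r ↦ r c] into [r ↦ c r]: the first form shows left linearity, the second right
    linearity. *)
Lemma coev_overE : coev_over = q D X ∘ (bcar D ◁ bract X) ∘ coext c R.
Proof. by rewrite coextE -(copairing_central bc) /coev_over extE ?compA. Qed.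

Lemma coev_over_one : coev_over ∘ aone R = q D X ∘ c.
Proof.
have -> : coev_over ∘ aone R
    = q D X ∘ ext (blact D) (bcar X) ∘ (R ◁ c) ∘ ucoext (aone R) 𝟙.
  by rewrite /coev_over ?compA runiti_nat runiti1 ucoextE.
rewrite -(ucoext_nat _ c) (tail (ext_ucoextl _ _)) (laction1 (blactP D)).
by rewrite tens1 comp1m.
Qed.

Lemma coev_over_bimod : is_bimodule_map (X := I) (Y := D ⊡ X) coev_over.
Proof.
split=> /=.
- rewrite /coev_over ?compA -ext_runiti -(tail2 (ext_nat m c)).
  rewrite (tail2 (lactionA (ext_laction (bcar X) (blactP D)))).
  by rewrite -!whiskl (tail (tlactE cq cf D X)) ?compA extE ?compA.
- rewrite coev_overE ?compA coext_nat -!whiskr (tail (tractE cq cf D X)) ?compA.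
  rewrite (tail2 (assoc_nat _ _ _)) assoc_coext !(tail (whiskl _ _)) ?compA.
  by rewrite -(extE (bract X)) (ractionA (bractP X)).
Qed.

Lemma dual_pairing_right_dual :
  exists (ev : bimodule_hom R (X ⊡ D) I) (coev : bimodule_hom R I (D ⊡ X)),
    is_right_dual (C := bimodule_moncat cq cf R) ev coev.
Proof.
exists (exist _ _ ev_over_bimod), (exist _ _ coev_over_bimod).
apply/right_dual_over; rewrite /= coev_over_one -whiskl -whiskr.
split.
- rewrite ?compA (tail (sigmai0E cq cf _ _ _)) ?compA (tail (tmapE _ _ _)) /= ?compA.
  by rewrite (tail (tlunitE cq X)) (tail (whiskr _ _)) ev_overE (pairing_zig bc).
- rewrite ?compA (tail (sigma0E cq cf _ _ _)) ?compA (tail (tmapE _ _ _)) /= ?compA.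
  by rewrite (tail (trunitE cq D)) (tail (whiskl _ _)) ev_overE (pairing_zag bc).
Qed.

End FromPairing.

(** * The forgetful functor to [C] preserves right duals *)

Section Forget.
Context {th : hom R 𝟙} {e : hom 𝟙 (R ⊗ R)}.
Context (frob : (m ▷ R) ∘ associ R R R ∘ (R ◁ e) ∘ runiti R
                = (R ◁ m) ∘ assoc R R R ∘ (e ▷ R) ∘ luniti R)
        (the : lunit R ∘ (th ▷ R) ∘ e = aone R)
        (eth : runit R ∘ (R ◁ th) ∘ e = aone R).

(* [x ⊗ y ↦ x e₁ ⊗ e₂ y]; its descent to [X ⊗_R Y] makes the forgetful functor
   to [C] Frobenius monoidal, and such functors preserve duals. *)
Definition split0 X Y : hom (bcar X ⊗ bcar Y) (bcar X ⊗ bcar Y) :=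
  locked ((bcar X ◁ blact Y) ∘ ext (bract X) (R ⊗ bcar Y) ∘ (bcar X ◁ coext e (bcar Y))).

Lemma split0E X Y : split0 X Y
  = (bcar X ◁ blact Y) ∘ ext (bract X) (R ⊗ bcar Y) ∘ (bcar X ◁ coext e (bcar Y)).
Proof. by rewrite /split0 -lock. Qed.

(** Centrality again: [x r e₁ ⊗ e₂ y = x e₁ ⊗ e₂ r y]. *)
Lemma split0_bal X Y : split0 X Y ∘ bal_l X Y = split0 X Y ∘ bal_r X Y.
Proof.
rewrite /bal_l /bal_r /= -assoc_ext -!compA; congr (_ ∘ _).
rewrite split0E ?compA -(ext_nat (bract X)) (tail2 (raction_ext _ (bractP X))).
rewrite !whiskl (casimir frob) coext_nat -!whiskl.
rewrite (tail2 (ext_nat (bract X) (ext m (bcar Y)))) (tail2 (ext_nat (bract X) (R ◁ blact Y))).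
by rewrite !(tail (whiskl _ _)) (lactionA (blactP Y)).
Qed.

Definition split_over X Y : hom (X ⊙ Y) (bcar X ⊗ bcar Y) :=
  coeq_desc (qmapP cq (bimod_r X) (bimod_l Y)) (split0_bal X Y).

Lemma split_overE X Y : split_over X Y ∘ q X Y = split0 X Y.
Proof. exact: coeq_descE. Qed.

Lemma split_over_nat X X' Y Y' (f : bimodule_hom R X X') (g : bimodule_hom R Y Y') :
  split_over X' Y' ∘ tmap cq f g = (proj1_sig f ⊗₁ proj1_sig g) ∘ split_over X Y.
Proof.
have [_ fr] := proj2_sig f; have [gl _] := proj2_sig g.
apply: qepi; rewrite ?compA tmapE (tail (split_overE _ _)) split_overE.
have -> : proj1_sig f ⊗₁ proj1_sig g = (proj1_sig f ▷ bcar Y') ∘ (bcar X ◁ proj1_sig g).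
  by rewrite comp_tens comp1m compm1.
rewrite !split0E ?compA -(tail2 (slide (proj1_sig f) _)) (tail (ext_whiskl _ _)) -fr.
rewrite ext_comp ?compA -(tail2 (slide (proj1_sig f) _)) !whiskl coext_nat -!whiskl.
by rewrite (tail2 (ext_nat (bract X) _)) !(tail (whiskl _ _)) gl.
Qed.

(* The two Frobenius conditions relating [q] and [split_over]. *)
Lemma split_over_sigmai X Y D :
  (q X Y ▷ bcar D) ∘ associ (bcar X) (bcar Y) (bcar D) ∘ (bcar X ◁ split_over Y D)
  = split_over (X ⊡ Y) D ∘ sigmai0 cq cf X Y D.
Proof.
apply: (lqepi cf); rewrite ?compA whiskl split_overE sigmai0E (tail (split_overE _ _)).
rewrite !split0E ?compA /=.
rewrite -(tail2 (slide (q X Y) _)) (tail (ext_whiskl _ _)) tractE ext_comp ?compA.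
rewrite -(tail2 (slide (q X Y) _)) -associ_natr.
rewrite (extE ((bcar X ◁ bract Y) ∘ assoc _ _ _)) -!whiskr ?compA.
rewrite (tail2 (pentB _ _ _ _)) ?compA (tail (associK _ _ _)) comp1m.
by rewrite -!whiskl (tail2 (associ_natr _)) extE -!whiskl ?compA (tail2 (associ_nat _ _ _)).
Qed.

Lemma split_over_sigma X Y D :
  (bcar X ◁ q Y D) ∘ assoc (bcar X) (bcar Y) (bcar D) ∘ (split_over X Y ▷ bcar D)
  = split_over X (Y ⊡ D) ∘ sigma0 cq cf X Y D.
Proof.
apply: (rqepi cf); rewrite ?compA whiskr split_overE sigma0E (tail (split_overE _ _)).
rewrite !split0E ?compA /=.
rewrite (tail (whiskl _ _)) coext_nat -!whiskl ?compA (tail2 (ext_nat (bract X) (R ◁ q Y D))).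
rewrite (tail (whiskl _ _)) tlactE -!whiskr -!whiskl ?compA.
rewrite (tail2 (assoc_nat _ _ _)) (tail2 (eq_sym (ext_assocC (bract X)))) ?compA.
rewrite assoc_nat (tail (whiskl (assoc R _ _) _)) assoc_coext -whiskl ?compA.
by rewrite (tail2 (ext_nat (bract X) (associ _ _ _))).
Qed.

(** Counit laws of the Frobenius monoidal structure: [θ(r e₁) e₂ x = r x] here, [x e₁ θ(e₂ r) = x r]
    in the next lemma. *)
Lemma split_over_counitl X : lunit (bcar X) ∘ (th ▷ bcar X) ∘ split_over I X = tlunit cq X.
Proof.
apply: qepi; rewrite ?compA split_overE tlunitE split0E (tail (eq_sym (uextE th _))).
rewrite (tail2 (uext_nat th _)).
by rewrite (counit_mul_casimir frob the) compm1.
Qed.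

Lemma split_over_counitr X : runit (bcar X) ∘ (bcar X ◁ th) ∘ split_over X I = trunit cq X.
Proof.
apply: qepi; rewrite ?compA split_overE trunitE split0E /=.
rewrite !(tail (whiskl _ _)) ?compA.
have e1 : runit R ∘ (R ◁ (th ∘ m)) ∘ coext e R = idm R.
  by rewrite -whiskl ?compA (mul_casimir_counit frob eth).
rewrite -(tail2 (ext_nat (bract X) _)) (tail2 (ext_runit (bract X))) !whiskl e1.
by rewrite tens1 compm1.
Qed.

(** A Frobenius condition moves [split_over] past the associator, naturality moves it past [ev], and
    a counit law absorbs it with [th]; what remains is the triangle identity over [R]. *)
Lemma right_dual_forget X D (ev : bimodule_hom R (X ⊡ D) I)
    (coev : bimodule_hom R I (D ⊡ X)) :
  is_right_dual (C := bimodule_moncat cq cf R) ev coev ->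
  is_right_dual (C := C) (th ∘ proj1_sig ev ∘ q X D)
    (split_over D X ∘ proj1_sig coev ∘ aone R).
Proof.
move/right_dual_over => [zig zag]; split.
- apply: eq_trans zig; rewrite -split_over_counitl -!whiskr -!whiskl ?compA.
  rewrite (tail2 (split_over_nat ev (id_ X))) /= ?compA.
  by rewrite (tail2 (eq_sym (split_over_sigmai _ _ _))) ?compA.
- apply: eq_trans zag; rewrite -split_over_counitr -!whiskr -!whiskl ?compA.
  rewrite (tail2 (split_over_nat (id_ D) ev)) /= ?compA.
  by rewrite (tail2 (eq_sym (split_over_sigma _ _ _))) ?compA.
Qed.

End Forget.
End OverR.

(** * Reversal of the tensor product, exchanging left and right duals *)

Section Reversal.

Definition rev_moncat (C : monoidal_category) : monoidal_category.
Proof.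
refine (@MonoidalCategory (mcat C) (fun a b => b ⊗ a)
  (fun a b c d f g => g ⊗₁ f) 𝟙
  (fun a b c => associ c b a) (fun a b c => assoc c b a)
  (@runit C) (@runiti C) (@lunit C) (@luniti C) _ _ _ _ _ _ _ _ _ _ _ _ _).
- by move=> a b; exact: tens1.
- by move=> a b c a' b' c' f g f' g'; exact: tensC.
- by move=> a b c; exact: associK.
- by move=> a b c; exact: assocK.
- by move=> a; exact: runitK.
- by move=> a; exact: runitiK.
- by move=> a; exact: lunitK.
- by move=> a; exact: lunitiK.
- by move=> a b c a' b' c' f g h; exact: associ_nat.
- by move=> a b f; exact: runit_nat.
- by move=> a b f; exact: lunit_nat.
- move=> a b c d.
  apply: (iso_mono (assocK (d ⊗ c) b a)).
  rewrite (tail (associK _ _ _)) comp1m (tail (pentC d c b a)).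
  rewrite ?compA (tail (associK _ _ _)) comp1m whiskl1 ?associK //.
  by rewrite compm1.
- by move=> a b; exact: triangle'.
Defined.

Context {C : monoidal_category}.

Definition rev_algebra (R : algebra C) : algebra (rev_moncat C).
Proof.
refine (@Algebra (rev_moncat C) (acar R) (amul R) (aone R) _ _ _).
- by rewrite /= (tail (amulA R)) ?compA associK compm1.
- exact: amul1r.
- exact: amul1l.
Defined.

Lemma rev_laction (R : algebra C) (Y : C) (nu : hom (Y ⊗ R) Y) :
  is_raction nu -> is_laction (C := rev_moncat C) (R := rev_algebra R) nu.
Proof. by case=> e e1; split=> //=; rewrite (tail e) ?compA associK compm1. Qed.

Lemma rev_raction (R : algebra C) (Y : C) (mu : hom (R ⊗ Y) Y) :
  is_laction mu -> is_raction (C := rev_moncat C) (R := rev_algebra R) mu.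
Proof. by case=> e e1; split=> //=; rewrite (tail e) ?compA associK compm1. Qed.

Lemma unrev_laction (R : algebra C) (Y : C) (mu : hom (R ⊗ Y) Y) :
  is_raction (C := rev_moncat C) (R := rev_algebra R) mu -> is_laction mu.
Proof. by case=> /= e e1; split=> //=; rewrite (tail e) ?compA assocK compm1. Qed.

Lemma unrev_raction (R : algebra C) (Y : C) (nu : hom (Y ⊗ R) Y) :
  is_laction (C := rev_moncat C) (R := rev_algebra R) nu -> is_raction nu.
Proof. by case=> /= e e1; split=> //=; rewrite (tail e) ?compA assocK compm1. Qed.

Definition rev_bimodule (R : algebra C) (X : bimodule R) : bimodule (rev_algebra R).
Proof.
refine (@Bimodule (rev_moncat C) (rev_algebra R) (bcar X) (bract X) (blact X)
  (rev_laction (bractP X)) (rev_raction (blactP X)) _).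
by rewrite /= (tail (bactA X)) ?compA associK compm1.
Defined.

Definition unrev_bimodule (R : algebra C) (X : bimodule (rev_algebra R)) : bimodule R.
Proof.
refine (@Bimodule C R (bcar X) (bract X) (blact X)
  (unrev_laction (bractP X)) (unrev_raction (blactP X)) _).
by have /= e := bactA X; rewrite (tail e) ?compA assocK compm1.
Defined.

Lemma rev_frobenius (R : algebra C) : frobenius R -> frobenius (rev_algebra R).
Proof. by case=> th [e [h [h1 h2]]]; exists th, e; split=> //=; rewrite h. Qed.

Lemma rev_separable (R : algebra C) : separable R -> separable (rev_algebra R).
Proof. by case=> gam [[h1 h2] h3]; exists gam. Qed.

(** Undoing the reversal swaps the two bimodules: [X] takes the place of the right dual, so
    [unrev_bimodule D] becomes a left dual of [X]. Working with pairings avoids comparing quotients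
    over [R] and over its reversal. *)
Lemma unrev_dual_pairing (R : algebra C) (X : bimodule R)
    (D : bimodule (rev_algebra R)) b c :
  dual_pairing (X := rev_bimodule X) (D := D) b c ->
  dual_pairing (X := unrev_bimodule D) (D := X) b c.
Proof.
case=> /= h1 h2 h3 h4 h5 h6; split=> //=.
- by rewrite (tail h1) ?compA assocK compm1.
- by rewrite -(compA (amul R)) -h3 ?compA assocK compm1.
- by rewrite (tail h2) ?compA assocK compm1.
Qed.

End Reversal.

(** * The equivalences for right and for left duals *)

Theorem corollary5p9 (C : monoidal_category) (cq : coequalizers C)
    (cf : forall Y : C, coflat Y)
    (rob : forall (A : algebra C) (Y : lmodule A), left_robust cq Y)
    (R : algebra C) (frobR : frobenius R) (sepR : separable R)
    (X : bimodule R) :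
  (has_right_dual (X : bimodule_moncat cq cf R) <-> has_right_dual (X : C))
  /\ (has_left_dual (X : bimodule_moncat cq cf R) <-> has_left_dual (X : C)).
Proof.
have [th [e [frob [the eth]]]] := frobR.
split; split.
- case=> D [ev [coev dual]].
  by do 3 eexists; exact: (right_dual_forget frob the eth dual).
- move=> dual; have [D [b [c bc]]] := dual_pairing_exists frobR sepR dual.
  have [ev [coev h]] := dual_pairing_right_dual (cq := cq) (cf := cf) bc.
  by exists D, ev, coev.
- case=> D [ev [coev [zig zag]]].
  (* [D] is a left dual of [X] exactly when [X] is a right dual of [D], with the two identities in
     the other order. *)
  have [h1 h2] := right_dual_forget frob the eth (conj zag zig).
  by do 3 eexists; split; [exact: h2 | exact: h1].
- case=> D [ev [coev [zig zag]]].
  (* A left dual in [C] is a right dual for the reversed tensor product, with the same [ev] and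
     [coev]. *)
  have dual : has_right_dual (C := rev_moncat C) (bcar (rev_bimodule X)).
    by exists D, ev, coev.
  have [D' [b [c bc]]] :=
    dual_pairing_exists (rev_frobenius frobR) (rev_separable sepR) dual.
  have [ev' [coev' [h1 h2]]] :=
    dual_pairing_right_dual (cq := cq) (cf := cf) (unrev_dual_pairing bc).
  by exists (unrev_bimodule D'), ev', coev'.
Qed.
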